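(* Let $M$ be a smooth manifold, $\mathfrak s$ a symmetry jet on $M$ and $\nabla^{\mathfrak s}$ the associated affine connection. There is a unique Lie groupoid morphism $S:\mathcal B^{(1)}\to\mathcal B^{(1,1)}_{sh}$ such that $S(-I_x)=\mathfrak s(x)$ for all $x\in M$ and $p\circ S=\mathrm{id}$. Moreover, the set of affine jets (with respect to $\nabla^{\mathfrak s}$) is precisely the image of $S$. When the symmetry jet $\mathfrak s$ is holonomic, the morphism $S$ takes its values in $\mathcal B^{(2)}$.
   Context: All objects are smooth. $\mathcal B^{(1)}$ is the Lie groupoid over $M$ of linear isomorphisms $\xi:T_xM\to T_yM$, with source $\alpha(\xi)=x$, target $\beta(\xi)=y$ and composition. $-I_x=-\mathrm{id}_{T_xM}$. A local bisection of a Lie groupoid $G\rightrightarrows M$ is a section $b:U\to G$ of $\alpha$ over an open $U$ with $b^0:=\beta\circ b$ a diffeomorphism onto an open set. The $1$-jets $j^1_xb$ of local bisections of $G$ form a Lie groupoid over $M$, with $\alpha(j^1_xb)=x$, $\beta(j^1_xb)=b^0(x)$ and $j^1_{b^0(x)}b'\cdot j^1_xb=j^1_x(b'\cdot b)$, where $(b'\cdot b)(x')=b'(b^0(x'))\cdot b(x')$. For $G=\mathcal B^{(1)}$ its elements are called $(1,1)$-jets, and $p(j^1_xb)=b(x)$, $p_*(j^1_xb)=(b^0)_{*_x}$ are groupoid morphisms to $\mathcal B^{(1)}$; $\mathcal B^{(1,1)}_{sh}$ is the subgroupoid of $(1,1)$-jets with $p=p_*$. $\mathcal B^{(2)}\subset\mathcal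 B^{(1,1)}_{sh}$ is the set of $2$-jets of local diffeomorphisms of $M$, where $j^2_xf$ is identified with the $1$-jet at $x$ of $x'\mapsto f_{*_{x'}}$. A symmetry jet is a smooth section $\mathfrak s:M\to\mathcal B^{(1,1)}_{sh}$ of $\alpha$ with $p(\mathfrak s(x))=-I_x$; it is holonomic if it takes values in $\mathcal B^{(2)}$. For a local bisection $b$ of $\mathcal B^{(1)}$ and a vector field $Y$, $bY$ is the local vector field $(bY)_{b^0(x')}=b(x')Y_{x'}$. The connection associated to $\mathfrak s$ is $(\nabla^{\mathfrak s}_XY)_x=\frac12[X,Y+s_xY]_x$ where $\mathfrak s(x)=j^1_xs_x$. An affine jet (with respect to $\nabla$) is an element $j^1_xb\in\mathcal B^{(1,1)}_{sh}$ such that $b(x)(\nabla_{X_x}Y)=\nabla_{b(x)X_x}(bY)$ for all $X_x\in T_xM$ and all vector fields $Y$. *)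

(* Defs.v *)
From HB Require Import structures.
From mathcomp Require Import all_boot all_order all_algebra.
From mathcomp Require Import all_classical all_reals all_analysis.

Set Implicit Arguments.
Unset Strict Implicit.
Unset Printing Implicit Defensive.

Import Order.TTheory GRing.Theory Num.Theory.
Import numFieldNormedType.Exports.

Local Open Scope classical_set_scope.
Local Open Scope ring_scope.

(* Smooth maps between (finite-dimensional) normed spaces.  U is meant to be  *)
(* open.  In finite dimension, continuity of all the iterated directional     *)
(* derivatives of order k is continuity of the k-th differential.             *)

Fixpoint Ck_on (R : realType) (V W : normedModType R) (k : nat)
    (U : set V) (f : V -> W) : Prop :=
  match k with
  | 0 => forall x, U x -> {for x, continuous f}
  | k.+1 => (forall x, U x -> differentiable f x) /\
            (forall v : V, Ck_on k U (fun x => 'D_v f x))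
  end.

Definition smooth_on (R : realType) (V W : normedModType R)
    (U : set V) (f : V -> W) : Prop := forall k, Ck_on k U f.

(* A smooth structure on a set T modelled on V is given by coordinate systems *)
(* (domain, coordinate map).  Since coordinate maps are injective with open   *)
(* image, "f is smooth near t" can be stated without their inverses: in all   *)
(* charts around t and f t, f is represented by a smooth map F near t; that f *)
(* maps a chart neighbourhood of t into the target chart is part of it.       *)

Definition atlas (R : realType) (T : Type) (V : normedModType R) : Type :=
  set (set T * (T -> V)).

Definition smooth_at (R : realType) (T T' : Type) (V V' : normedModType R)
    (A : atlas T V) (A' : atlas T' V') (f : T -> T') (t : T) : Prop :=
  forall c c', A c -> A' c' -> c.1 t -> c'.1 (f t) ->
  exists (W : set V) (F : V -> V'),
    [/\ open W, W (c.2 t), smooth_on W F &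
        forall t', c.1 t' -> W (c.2 t') ->
                   c'.1 (f t') /\ c'.2 (f t') = F (c.2 t')].

Definition smooth_map (R : realType) (T T' : Type) (V V' : normedModType R)
    (A : atlas T V) (A' : atlas T' V') (f : T -> T') : Prop :=
  forall t, smooth_at A A' f t.

(* cinv is only meaningful on cmap @` cdom. *)
Record chart (R : realType) (n : nat) (T : Type) := Chart {
  cdom : set T;
  cmap : T -> 'rV[R]_n;
  cinv : 'rV[R]_n -> T
}.

Record manifold (R : realType) (n : nat) := Manifold {
  msort :> topologicalType;
  charts : set (chart R n msort);
  m_hausdorff : hausdorff_space msort;
  m_second_countable : @second_countable msort;
  m_cover : forall x : msort, exists c, charts c /\ cdom c x;
  m_dom_open : forall c, charts c -> open (cdom c);
  m_img_open : forall c, charts c -> open (cmap c @` cdom c);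
  m_cmapK : forall c, charts c -> forall x, cdom c x -> cinv c (cmap c x) = x;
  m_cmap_cont : forall c, charts c ->
    forall x, cdom c x -> {for x, continuous (cmap c)};
  m_cinv_cont : forall c, charts c ->
    forall u, (cmap c @` cdom c) u -> {for u, continuous (cinv c)};
  m_compat : forall c c', charts c -> charts c' ->
    smooth_on (cmap c @` (cdom c `&` cdom c')) (cmap c' \o cinv c)
}.

Arguments charts {R n} m.

Definition matlas (R : realType) (n : nat) (M : manifold R n) :
    atlas M 'rV[R]_n :=
  [set (cdom c, cmap c) | c in charts M].

Arguments matlas {R n} M.

Definition chart_at (R : realType) (n : nat) (M : manifold R n) (x : M) :
    chart R n M :=
  projT1 (cid (m_cover x)).

(* T_xM is represented by 'rV_n, a tangent vector at x being given by its     *)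
(* components in the chart chart_at x.  Linear maps act on row vectors on the *)
(* right (as for 'J, where 'd f a v = v *m 'J f a).                           *)

(* Components in the chart c of v in T_xM are v *m tcoord c x. *)
Definition tcoord (R : realType) (n : nat) (M : manifold R n)
    (c : chart R n M) (x : M) : 'M[R]_n :=
  'J (cmap c \o cinv (chart_at x)) (cmap (chart_at x) x).

(* Matrix of the differential f_{*_x} : T_xM -> T_{f x}M. *)
Definition tmap (R : realType) (n : nat) (M : manifold R n)
    (f : M -> M) (x : M) : 'M[R]_n :=
  'J (cmap (chart_at (f x)) \o f \o cinv (chart_at x)) (cmap (chart_at x) x).

(* A possibly local vector field is extended by arbitrary values. *)
Definition vfield (R : realType) (n : nat) (M : manifold R n) : Type :=
  M -> 'rV[R]_n.

Definition vrep (R : realType) (n : nat) (M : manifold R n)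
    (c : chart R n M) (X : vfield M) (u : 'rV[R]_n) : 'rV[R]_n :=
  X (cinv c u) *m tcoord c (cinv c u).

Definition smooth_vfield (R : realType) (n : nat) (M : manifold R n)
    (X : vfield M) : Prop :=
  forall c, charts M c -> smooth_on (cmap c @` cdom c) (vrep c X).

(* [X, Y]_x for X, Y smooth near x, with the sign for which                   *)
(* [X, Y] f = X (Y f) - Y (X f); computed in the chart at x, so that the      *)
(* result is directly an element of T_xM.                                     *)
Definition bracket (R : realType) (n : nat) (M : manifold R n)
    (X Y : vfield M) (x : M) : 'rV[R]_n :=
  let c := chart_at x in
  let u := cmap c x in
  'D_(vrep c X u) (vrep c Y) u - 'D_(vrep c Y u) (vrep c X) u.

(* The groupoid B^(1): linear isomorphisms T_xM -> T_yM. *)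

Record B1 (R : realType) (n : nat) (M : manifold R n) := MkB1 {
  bsrc : M;
  btgt : M;
  bmx : 'M[R]_n;
  bmx_unit : bmx \in unitmx
}.

(* The composite eta . xi ; only meaningful when bsrc eta = btgt xi. *)
Definition B1mul (R : realType) (n : nat) (M : manifold R n)
    (eta xi : B1 M) : B1 M :=
  @MkB1 R n M (bsrc xi) (btgt eta) (bmx xi *m bmx eta)
    (etrans (unitmx_mul _ _) (introT andP (conj (bmx_unit xi) (bmx_unit eta)))).

Lemma unitmxN1 (R : realType) (n : nat) : - 1%:M \in @unitmx R n.
Proof.
have h : - 1%:M *m - 1%:M = 1%:M :> 'M[R]_n by rewrite mulmxN mulmx1 opprK.
by case: (mulmx1_unit h).
Qed.

(* - I_x *)
Definition B1neg (R : realType) (n : nat) (M : manifold R n) (x : M) : B1 M :=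
  MkB1 x x (unitmxN1 R n).

Definition B1coord (R : realType) (n : nat) (M : manifold R n)
    (c d : chart R n M) (xi : B1 M) : 'rV[R]_n * 'rV[R]_n * 'M[R]_n :=
  (cmap c (bsrc xi), cmap d (btgt xi),
   invmx (tcoord c (bsrc xi)) *m bmx xi *m tcoord d (btgt xi)).

(* Coordinates take values in the open set c(U) x d(V) x GL_n. *)
Definition B1atlas (R : realType) (n : nat) (M : manifold R n) :
    atlas (B1 M) ('rV[R]_n * 'rV[R]_n * 'M[R]_n)%type :=
  [set C | exists c d, [/\ charts M c, charts M d &
     C = ([set xi : B1 M | cdom c (bsrc xi) /\ cdom d (btgt xi)],
          B1coord c d)]].

Arguments B1atlas {R n} M.

(* Local bisections of B^(1); the values of bfun outside bdom are arbitrary. *)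

Definition bbase (R : realType) (n : nat) (M : manifold R n)
    (b : M -> B1 M) : M -> M := fun x => btgt (b x).

Record bisection (R : realType) (n : nat) (M : manifold R n) := Bisection {
  bdom : set M;
  bfun :> M -> B1 M;
  bis_open : open bdom;
  bis_src : forall x, bdom x -> bsrc (bfun x) = x;
  bis_smooth : forall x, bdom x -> smooth_at (matlas M) (B1atlas M) bfun x;
  bis_img_open : open (bbase bfun @` bdom);
  bis_diffeo : exists g : M -> M,
    (forall x, bdom x -> g (bbase bfun x) = x) /\
    (forall y, (bbase bfun @` bdom) y -> smooth_at (matlas M) (matlas M) g y)
}.

Definition bisection_mul (R : realType) (n : nat) (M : manifold R n)
    (b' b : M -> B1 M) : M -> B1 M :=
  fun x => B1mul (b' (bbase b x)) (b x).

(* bY, extended by 0 outside b^0(bdom b). *)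
Definition push (R : realType) (n : nat) (M : manifold R n)
    (b : bisection M) (Y : vfield M) : vfield M :=
  fun y => match pselect (exists x, bdom b x /\ bbase b x = y) with
           | left h => let x := projT1 (cid h) in Y x *m bmx (b x)
           | right _ => 0
           end.

(* (1,1)-jets: a jet is a point together with a class of local bisections     *)
(* around it, for equality of the values and of the first derivatives at the  *)
(* point, the latter read in charts of M and B^(1).                           *)

Definition same_jet1 (R : realType) (n : nat) (M : manifold R n)
    (x : M) (b b' : M -> B1 M) : Prop :=
  let c := chart_at x in
  let d := chart_at (bbase b x) in
  b x = b' x /\
  'd (B1coord c d \o b \o cinv c) (cmap c x) =
  'd (B1coord c d \o b' \o cinv c) (cmap c x)
    :> ('rV[R]_n -> 'rV[R]_n * 'rV[R]_n * 'M[R]_n).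

Definition jet1_class (R : realType) (n : nat) (M : manifold R n)
    (x : M) (b : M -> B1 M) : set (bisection M) :=
  [set b' | bdom b' x /\ same_jet1 x b b'].

Record jet (R : realType) (n : nat) (M : manifold R n) := Jet {
  jsrc : M;
  jcls : set (bisection M);
  jet_ex : exists b : bisection M, bdom b jsrc /\ jcls = jet1_class jsrc b
}.

(* A local bisection representing the jet. *)
Definition jrep (R : realType) (n : nat) (M : manifold R n) (J : jet M) :
    bisection M :=
  projT1 (cid (jet_ex J)).

Definition jp (R : realType) (n : nat) (M : manifold R n) (J : jet M) : B1 M :=
  jrep J (jsrc J).

Definition jtgt (R : realType) (n : nat) (M : manifold R n) (J : jet M) : M :=
  bbase (jrep J) (jsrc J).

(* Matrix of p_*(J) : T_{jsrc J}M -> T_{jtgt J}M. *)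
Definition jpstar (R : realType) (n : nat) (M : manifold R n) (J : jet M) :
    'M[R]_n :=
  tmap (bbase (jrep J)) (jsrc J).

(* J' . J = J'', including composability. *)
Definition jet_mul (R : realType) (n : nat) (M : manifold R n)
    (J' J J'' : jet M) : Prop :=
  [/\ jsrc J' = jtgt J, jsrc J'' = jsrc J &
      same_jet1 (jsrc J) (bisection_mul (jrep J') (jrep J)) (jrep J'')].

(* B^(1,1)_sh. The condition is p = p_*; sources and targets always agree. *)
Record shjet (R : realType) (n : nat) (M : manifold R n) := ShJet {
  shval :> jet M;
  sh_eq : bmx (jp shval) = jpstar shval
}.

(* Besides the coordinates of p(j^1_x b), the partial derivatives at x of the *)
(* matrix coordinate of b: row i is the (flattened) derivative along the i-th *)
(* coordinate.  The derivative of b^0 is p_*, which is p here.                *)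
Definition shjet_coord (R : realType) (n : nat) (M : manifold R n)
    (c d : chart R n M) (J : shjet M) :
    'rV[R]_n * 'rV[R]_n * 'M[R]_n * 'M[R]_(n, n * n) :=
  (B1coord c d (jp J),
   'J (fun u => mxvec (B1coord c d (jrep J (cinv c u))).2) (cmap c (jsrc J))).

Definition shjet_atlas (R : realType) (n : nat) (M : manifold R n) :
    atlas (shjet M)
      ('rV[R]_n * 'rV[R]_n * 'M[R]_n * 'M[R]_(n, n * n))%type :=
  [set C | exists c d, [/\ charts M c, charts M d &
     C = ([set J : shjet M | cdom c (jsrc J) /\ cdom d (jtgt J)],
          shjet_coord c d)]].

Arguments shjet_atlas {R n} M.

(* B^(2): jets represented by x' |-> f_{*_x'}, f a local diffeomorphism (f is *)
(* then the base map of a local bisection).                                   *)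
Definition holonomic_jet (R : realType) (n : nat) (M : manifold R n)
    (J : jet M) : Prop :=
  exists (f : M -> M) (b : bisection M),
    jcls J b /\
    forall x, bdom b x -> btgt (b x) = f x /\ bmx (b x) = tmap f x.

Definition symmetry_jet (R : realType) (n : nat) (M : manifold R n)
    (s : M -> shjet M) : Prop :=
  [/\ smooth_map (matlas M) (shjet_atlas M) s,
      (forall x, jsrc (s x) = x) &
      (forall x, jp (s x) = B1neg x)].

Definition holonomic_symmetry_jet (R : realType) (n : nat) (M : manifold R n)
    (s : M -> shjet M) : Prop :=
  forall x, holonomic_jet (s x).

Definition nabla (R : realType) (n : nat) (M : manifold R n)
    (s : M -> shjet M) (X Y : vfield M) : vfield M :=
  fun x => 2^-1 *: bracket X (fun z => Y z + push (jrep (s x)) Y z) x.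

(* The local vector field with value v at x and constant components in the    *)
(* chart at x; covariant derivatives along a vector v in T_xM are taken along *)
(* this extension.                                                            *)
Definition extend (R : realType) (n : nat) (M : manifold R n)
    (x : M) (v : 'rV[R]_n) : vfield M :=
  fun z => v *m invmx (tcoord (chart_at x) z).

Definition affine_jet (R : realType) (n : nat) (M : manifold R n)
    (D : vfield M -> vfield M -> vfield M) (J : shjet M) : Prop :=
  let x := jsrc J in
  let y := jtgt J in
  let b := jrep J in
  forall (v : 'rV[R]_n) (Y : vfield M), smooth_vfield Y ->
    D (extend x v) Y x *m bmx (b x) =
    D (extend y (v *m bmx (b x))) (push b Y) y.

(* Preservation of sources, targets and units follows from that of composable *)
(* pairs and products.                                                        *)
Definition lie_groupoid_morphism (R : realType) (n : nat) (M : manifold R n)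
    (S : B1 M -> shjet M) : Prop :=
  smooth_map (B1atlas M) (shjet_atlas M) S /\
  forall eta xi : B1 M, bsrc eta = btgt xi ->
    jet_mul (S eta) (S xi) (S (B1mul eta xi)).

(* Main.v *)
(* In charts c around x and d around y, an element J of B^(1,1)_sh is a matrix B
   together with the derivative DB of its matrix part.  Writing K for the
   derivative of the matrix part of s, the connection is
   D_v Y - 1/2 Y K(v), and for J the three conditions
   - J is affine,
   - s(y) . J = J . s(x),
   - DB(v) = 1/2 (B K_y(v B) - K_x(v) B) for all v
   are equivalent.  The third one determines J from its image xi under p, which
   defines S(xi); it is multiplicative in xi and depends smoothly on it.  A
   morphism S' as in the statement satisfies the second one, because xi commutes
   with - I; this gives uniqueness.  The jet S(xi) is realised by composing
   representatives of s(x) and s(y) with affine maps in the charts (see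
   [symmetric_bisection]), which keeps holonomic representatives holonomic.
   That an affine jet satisfies the third condition requires globally defined
   vector fields with arbitrary value at x, obtained from bump functions. *)

(* The factor 1/2 comes from a sign. Both p and p_* of s(x) are - id, so in J . s(x) two signs meet
   at DB and cancel, while in s(y) . J only one acts on it. Commutation therefore reads 2 DB(v) = B
   K_y(v B) - K_x(v) B.

   For existence the obstacle is holonomy. A matrix-valued function with a prescribed derivative is
   easy to write down, but in the holonomic case it must moreover be the differential of a local
   diffeomorphism. Composing the given representatives with affine maps yields the formula and this
   property at once.

   A jet is a class of bisections from which [jrep] picks an arbitrary member, and tangent vectors
   are read in preferred charts that jump from point to point. Jets are therefore reduced to three
   data in fixed charts, namely the value, [bP] and [bD]; how these change with the charts depends
   on nothing else. *)
Require Import Defs.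
From HB Require Import structures.
From mathcomp Require Import all_boot all_order all_algebra.
From mathcomp Require Import all_classical all_reals all_analysis.
From mathcomp Require Import ring.
Import Order.TTheory GRing.Theory Num.Theory.
Import numFieldNormedType.Exports.
Local Open Scope classical_set_scope.
Local Open Scope ring_scope.

Set Implicit Arguments.
Unset Strict Implicit.
Unset Printing Implicit Defensive.

(** * Differentials and smooth maps *)

Section Differentials.
Variable R : realType.
Implicit Types U V W Z : normedModType R.

Lemma near_zero_is_diff V W (h : V -> W) (a : V) :
  (\forall x \near a, h x = 0) -> is_diff a h (fun=> 0).
Proof.
move=> h0.
have ha : h a = 0 by exact: nbhs_singleton h0.
have c0 : continuous (\0 : V -> W) by move=> y; exact: cst_continuous.
have E : h \o shift a = cst (h a) + (\0 : V -> W) +o_ (0 : V) id.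
  apply/eqaddoP => e e0.
  have h1 : \forall x \near (0 : V), h (x + a) = 0.
    have := h0; rewrite (near_shift (0 : V) a) /=.
    by apply: filterS => x /=; rewrite subr0.
  apply: filterS h1 => x hx.
  have -> : (h \o shift a - (cst (h a) + (\0 : V -> W))) x = 0.
    by rewrite !fctE /= hx ha addr0 subr0.
  by rewrite normr0 mulr_ge0 // ltW.
have dE : 'd h a = \0 :> (V -> W) by apply: diff_unique.
apply: DiffDef => //; apply/diff_locallyP; rewrite dE; split => //.
Qed.

(** Write [g] as [f + (g - f)]: the second summand vanishes near [a], so its differential is
    zero. *)
Lemma near_is_diff V W (f g df : V -> W) (a : V) :
  (\forall x \near a, f x = g x) -> is_diff a f df -> is_diff a g df.
Proof.
move=> fg fd.
have gf : \forall x \near a, (g - f) x = 0.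
  by apply: filterS fg => x; rewrite !fctE => ->; rewrite subrr.
have := is_diffD fd (near_zero_is_diff gf).
rewrite (_ : f + (g - f) = g); last by rewrite addrC subrK.
by move/is_diff_eq; apply; apply/funext => x; rewrite !fctE addr0.
Qed.

Lemma near_differentiable V W (f g : V -> W) (a : V) :
  (\forall x \near a, f x = g x) -> differentiable f a -> differentiable g a.
Proof.
by move=> fg /differentiableP /(near_is_diff fg) [].
Qed.

Lemma is_diff_derive V W (f df : V -> W) a v :
  is_diff a f df -> 'D_v f a = df v.
Proof. by case=> fd dfE; rewrite deriveE // dfE. Qed.

Lemma is_diff_of V W (f df : V -> W) a : differentiable f a ->
  (forall v, 'D_v f a = df v) -> is_diff a f df.
Proof.
by move=> fd fE; apply: DiffDef => //; apply/funext => v; rewrite -fE deriveE.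
Qed.

Lemma linear_is_diff V W (f : V -> W) a :
  linear f -> continuous f -> is_diff a f f.
Proof.
move=> lf cf.
pose fM := GRing.isLinear.Build _ _ _ _ _ lf.
pose fL : {linear _ -> _} := HB.pack f fM.
rewrite -[f]/(fL : _ -> _).
by apply: DiffDef; [exact: linear_differentiable|exact: diff_lin].
Qed.

Lemma mx_linear_continuous m n W (f : 'M[R]_(m, n) -> W) :
  linear f -> continuous f.
Proof.
move=> lf.
pose fM := GRing.isLinear.Build _ _ _ _ _ lf.
pose fL : {linear _ -> _} := HB.pack f fM.
have -> : f = fun x => \sum_i \sum_j x i j *: f (delta_mx i j).
  apply/funext => x; rewrite -[f]/(fL : _ -> _) {1}(matrix_sum_delta x).
  rewrite linear_sum; apply: eq_bigr => i _; rewrite linear_sum.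
  by apply: eq_bigr => j _; rewrite linearZ.
move=> x; have FF := nbhs_filter x.
apply: (@cvg_big _ _ _ _ _ (@add_continuous W) _ (nbhs x)) => i _.
apply: (@cvg_big _ _ _ _ _ (@add_continuous W) _ (nbhs x)) => j _.
by apply: cvgZr_tmp; exact: coord_continuous.
Qed.

(** [B] is a bare function whose bilinear structure is bundled on the spot; continuity is a separate
    hypothesis because the spaces are arbitrary normed spaces. *)
Lemma bilinear_is_diff U V W Z (B : U -> V -> W)
  (f df : Z -> U) (g dg : Z -> V) x :
  (forall u, linear (B u)) -> (forall v, linear (B^~ v)) ->
  continuous (fun p : U * V => B p.1 p.2) ->
  is_diff x f df -> is_diff x g dg ->
  is_diff x (fun y => B (f y) (g y)) (fun v => B (df v) (g x) + B (f x) (dg v)).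
Proof.
move=> lB rB cB fd gd.
have bB : bilinear_for (GRing.Scale.Law.clone _ _ *:%R _)
  (GRing.Scale.Law.clone _ _ *:%R _) B by split=> ? ? ? ?; rewrite ?rB ?lB.
pose BM := bilinear_isBilinear.Build R U V W _ _ B bB.
pose BL : {bilinear U -> V -> W} := HB.pack B BM.
have d1 : is_diff (f x, g x) (fun p : U * V => B p.1 p.2)
    (fun q => B (f x) q.2 + B q.1 (g x)).
  by rewrite -[B]/(BL : _ -> _ -> _); apply: DiffDef;
    [exact: differentiable_bilin|rewrite diff_bilin].
have := is_diff_comp (is_diff_pair fd gd) d1.
by move/is_diff_eq; apply; apply/funext => v /=; rewrite addrC.
Qed.

Lemma mx_cvg (T : Type) (F : set_system T) (FF : Filter F) m n
  (f : T -> 'M[R]_(m, n)) (M : 'M[R]_(m, n)) :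
  (forall i j, f t i j @[t --> F] --> M i j) -> f @ F --> M.
Proof.
move=> fM A [P MP PA].
have : \forall t \near F, forall ij, P ij.1 ij.2 (f t ij.1 ij.2).
  by apply: filter_forall => -[i j]; apply: (fM i j); exact: MP.
by apply: filterS => t Pt; apply: PA => i j; exact: (Pt (i, j)).
Qed.

Lemma mulmx_continuous m n p :
  continuous (fun q : 'M[R]_(m, n) * 'M[R]_(n, p) => q.1 *m q.2).
Proof.
move=> q; apply: mx_cvg => i j.
under eq_fun do rewrite mxE.
rewrite mxE.
apply: (@cvg_big _ _ _ _ _ (@add_continuous R) _ (nbhs q)) => k _.
apply: cvgM.
  by apply: (cvg_comp (fst : _ -> 'M[R]_(m, n)) (fun N : 'M[R]_(m, n) => N i k));
    [exact: cvg_fst|exact: coord_continuous].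
by apply: (cvg_comp (snd : _ -> 'M[R]_(n, p)) (fun N : 'M[R]_(n, p) => N k j));
    [exact: cvg_snd|exact: coord_continuous].
Qed.

End Differentials.

(** * Closure properties of C^k and smooth maps *)

Section Smooth.
Variable R : realType.
Implicit Types U V W Z : normedModType R.

Lemma Ck_on_sub V W k (A B : set V) (f : V -> W) :
  A `<=` B -> Ck_on k B f -> Ck_on k A f.
Proof.
elim: k f => [|k IH] f AB /=; first by move=> fB x /AB; exact: fB.
by move=> [fB DB]; split=> [x /AB|v]; [exact: fB|exact: IH].
Qed.

(** The derivatives in [Ck_on] are taken in the ambient space, so the condition at a point does not
    refer to the set. This makes smoothness local, as used in [smooth_on_local]. *)
Lemma Ck_onP V W k (A : set V) (f : V -> W) :
  (forall x, A x -> Ck_on k [set x] f) -> Ck_on k A f.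
Proof.
elim: k f => [|k IH] f /= fA; first by move=> x /fA; apply.
split=> [x /fA[+ _]|v]; first exact.
by apply: IH => x /fA[].
Qed.

Lemma Ck_on_le V W k (A : set V) (f : V -> W) :
  Ck_on k.+1 A f -> Ck_on k A f.
Proof.
elim: k f => [|k IH] f; first by case=> + _ x Ax => /(_ x Ax) /differentiable_continuous.
by move=> [fA DA]; split=> // v; exact/IH/DA.
Qed.

Lemma near_eq_in V W (A : set V) (f g : V -> W) x : open A -> A x ->
  (forall y, A y -> f y = g y) -> \forall y \near x, f y = g y.
Proof.
by move=> oA Ax fg; apply: filterS fg _; exact: open_nbhs_nbhs.
Qed.

Lemma Ck_on_eq V W k (A : set V) (f g : V -> W) : open A ->
  (forall x, A x -> f x = g x) -> Ck_on k A f -> Ck_on k A g.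
Proof.
move=> oA; elim: k f g => [|k IH] f g fg /=.
  move=> fA x Ax; have fx : f @ x --> f x by exact: fA.
  rewrite (fg x Ax) in fx; apply: cvg_trans fx; apply: near_eq_cvg.
  exact: near_eq_in oA Ax fg.
move=> [fA DA]; split=> [x Ax|v].
  by apply: near_differentiable (fA x Ax); exact: near_eq_in oA Ax fg.
apply: IH (DA v) => x Ax; apply: near_eq_derive; exact: near_eq_in oA Ax fg.
Qed.

(** Lets the recursion in [Ck_on] run on an explicit formula for the differential instead of on
    ['D_v f]. *)
Lemma Ck_on_is_diff V W k (A : set V) (f : V -> W) (df : V -> V -> W) :
  open A -> (forall x, A x -> is_diff x f (df x)) ->
  (forall v, Ck_on k A (fun x => df x v)) -> Ck_on k.+1 A f.
Proof.
move=> oA fd Cd; split=> [x Ax|v]; first by case: (fd x Ax).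
by apply: (Ck_on_eq oA _ (Cd v)) => x Ax; rewrite (is_diff_derive _ (fd x Ax)).
Qed.

Lemma Ck_on_cst V W k (A : set V) (c : W) : Ck_on k A (fun=> c).
Proof.
elim: k c => [|k IH] c /=; first by move=> x _; exact: cst_continuous.
split=> [x _|v]; first exact: differentiable_cst.
have -> : (fun x => 'D_v (fun=> c) x) = (fun=> 0 : W) by apply/funext => x; exact: derive_cst.
exact: IH.
Qed.

Lemma Ck_on_lin V W k (A : set V) (L : V -> W) :
  linear L -> continuous L -> Ck_on k A L.
Proof.
move=> lL cL; case: k => [|k]; first by move=> x _; exact: cL.
split=> [x _|v]; first by case: (linear_is_diff x lL cL).
have -> : (fun x => 'D_v L x) = (fun=> L v).
  by apply/funext => x; rewrite (is_diff_derive _ (linear_is_diff x lL cL)).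
exact: Ck_on_cst.
Qed.

Lemma Ck_on_is_diff_derive V W k (A : set V) (f : V -> W) x :
  Ck_on k.+1 A f -> A x -> is_diff x f (fun v => 'D_v f x).
Proof. by move=> [fA _] Ax; apply: is_diff_of => //; exact: fA. Qed.

Lemma Ck_on_lin_comp V W Z k (A : set V) (f : V -> W) (L : W -> Z) :
  open A -> linear L -> continuous L -> Ck_on k A f -> Ck_on k A (L \o f).
Proof.
move=> oA lL cL; elim: k f => [|k IH] f fC.
  move=> x Ax; apply: continuous_comp; [exact: fC|exact: cL].
apply: (@Ck_on_is_diff _ _ _ _ _ (fun x v => L ('D_v f x))) => // [x Ax|v].
  exact: is_diff_comp (Ck_on_is_diff_derive fC Ax) (linear_is_diff _ lL cL).
by apply: (IH (fun x => 'D_v f x)); case: fC => _; apply.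
Qed.

Lemma Ck_on_comp_lin V W Z k (A : set V) (B : set W) (L : V -> W) (f : W -> Z) :
  open A -> linear L -> continuous L -> (forall x, A x -> B (L x)) ->
  Ck_on k B f -> Ck_on k A (f \o L).
Proof.
move=> oA lL cL AB; elim: k f => [|k IH] f fC.
  move=> x Ax; apply: continuous_comp; [exact: cL|exact: fC _ (AB _ Ax)].
apply: (@Ck_on_is_diff _ _ _ _ _ (fun x v => 'D_(L v) f (L x))) => // [x Ax|v].
  exact: is_diff_comp (linear_is_diff _ lL cL) (Ck_on_is_diff_derive fC (AB _ Ax)).
by apply: (IH (fun y => 'D_(L v) f y)); case: fC => _; apply.
Qed.

Lemma Ck_on_pair V W Z k (A : set V) (f : V -> W) (g : V -> Z) :
  open A -> Ck_on k A f -> Ck_on k A g -> Ck_on k A (fun x => (f x, g x)).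
Proof.
move=> oA; elim: k f g => [|k IH] f g fC gC.
  by move=> x Ax; apply: cvg_pair; [exact: fC|exact: gC].
apply: (@Ck_on_is_diff _ _ _ _ _ (fun x v => ('D_v f x, 'D_v g x))) => // [x Ax|v].
  exact: is_diff_pair (Ck_on_is_diff_derive fC Ax) (Ck_on_is_diff_derive gC Ax).
by apply: IH; [case: fC => _; apply|case: gC => _; apply].
Qed.

Lemma Ck_on_add V W k (A : set V) (f g : V -> W) :
  open A -> Ck_on k A f -> Ck_on k A g -> Ck_on k A (fun x => f x + g x).
Proof.
move=> oA fC gC.
apply: (@Ck_on_lin_comp _ _ _ _ _ _ (fun p : W * W => p.1 + p.2) oA _ _ (Ck_on_pair oA fC gC)).
  by move=> a [u1 u2] [v1 v2] /=; rewrite scalerDr addrACA.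
exact: add_continuous.
Qed.

Lemma Ck_on_sum V W k (A : set V) (I : Type) (r : seq I) (f : I -> V -> W) :
  open A -> (forall i, Ck_on k A (f i)) -> Ck_on k A (fun x => \sum_(i <- r) f i x).
Proof.
move=> oA fC; elim: r => [|i r IH].
  by under eq_fun do rewrite big_nil; exact: Ck_on_cst.
by under eq_fun do rewrite big_cons; exact: Ck_on_add.
Qed.

Lemma Ck_on_scale V W k (A : set V) (c : R) (f : V -> W) :
  open A -> Ck_on k A f -> Ck_on k A (fun x => c *: f x).
Proof.
move=> oA fC; apply: (@Ck_on_lin_comp _ _ _ _ _ _ (fun u : W => c *: u) oA _ _ fC).
  by move=> a u v; rewrite scalerDr !scalerA mulrC.
exact: scaler_continuous.
Qed.

Lemma Ck_on_bilin V W1 W2 Z k (A : set V) (B : W1 -> W2 -> Z)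
    (f : V -> W1) (g : V -> W2) : open A ->
  (forall u, linear (B u)) -> (forall v, linear (B^~ v)) ->
  continuous (fun p : W1 * W2 => B p.1 p.2) ->
  Ck_on k A f -> Ck_on k A g -> Ck_on k A (fun x => B (f x) (g x)).
Proof.
move=> oA lB rB cB; elim: k f g => [|k IH] f g fC gC.
  move=> x Ax; apply: (@continuous_comp _ _ _ (fun x => (f x, g x))
    (fun p : W1 * W2 => B p.1 p.2)).
    by apply: cvg_pair; [exact: fC|exact: gC].
  exact: cB.
apply: (@Ck_on_is_diff _ _ _ _ _
  (fun x v => B ('D_v f x) (g x) + B (f x) ('D_v g x))) => // [x Ax|v].
  apply: (@bilinear_is_diff _ _ _ _ _ B) => //.
    exact: Ck_on_is_diff_derive fC Ax.
  exact: Ck_on_is_diff_derive gC Ax.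
have [_ Df] := fC; have [_ Dg] := gC.
(* Each term of the Leibniz rule is again [B] of two functions: one is a derivative, the other is
   lowered to order [k]. *)
by apply: Ck_on_add => //; apply: (IH _ _) => //; first [exact: Df|exact: Dg|exact: Ck_on_le].
Qed.

Lemma Ck_on_mulmx V k (A : set V) m n p (f : V -> 'M[R]_(m, n))
    (g : V -> 'M[R]_(n, p)) : open A ->
  Ck_on k A f -> Ck_on k A g -> Ck_on k A (fun x => f x *m g x).
Proof.
move=> oA; apply: (@Ck_on_bilin _ _ _ _ _ _ (@mulmx R m n p)) => //.
- by move=> u a v w; rewrite linearP.
- by move=> u a v w; rewrite mulmxDl scalemxAl.
- exact: mulmx_continuous.
Qed.

Lemma Ck_on_scaler V W k (A : set V) (f : V -> R) (g : V -> W) : open A ->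
  Ck_on k A f -> Ck_on k A g -> Ck_on k A (fun x => f x *: g x).
Proof.
move=> oA; apply: (@Ck_on_bilin _ _ _ _ _ _ (@GRing.scale R W)) => //.
- by move=> u a v w; rewrite scalerDr !scalerA mulrC.
- by move=> u a v w /=; rewrite scalerDl scalerA.
- exact: scale_continuous.
Qed.

Lemma Ck_on_mx V k (A : set V) m n (f : V -> 'M[R]_(m, n)) : open A ->
  (forall i j, Ck_on k A (fun x => f x i j : R)) -> Ck_on k A f.
Proof.
move=> oA fC.
apply: (@Ck_on_eq _ _ _ _ (fun x => \sum_i \sum_j f x i j *: delta_mx i j)) => //.
  by move=> x _; rewrite -matrix_sum_delta.
apply: Ck_on_sum => // i; apply: Ck_on_sum => // j.
by apply: Ck_on_scaler => //; exact: Ck_on_cst.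
Qed.

(** In the derivative of a composite, the direction in which [g] is differentiated moves with [x].
    Expanding it in the basis leaves only fixed directions, the ones that [Ck_on] speaks of; hence
    the middle space of [Ck_on_comp] consists of row vectors. *)
Lemma row_derive_comp V W n (f : V -> 'rV[R]_n) (g : 'rV[R]_n -> W) x v :
  differentiable f x -> differentiable g (f x) ->
  'D_v (g \o f) x = \sum_j ('D_v f x) 0 j *: 'D_(delta_mx 0 j) g (f x).
Proof.
move=> fd gd.
have gfd := is_diff_comp (differentiableP fd) (differentiableP gd).
rewrite (is_diff_derive _ gfd) /= -(deriveE _ fd) {1}(row_sum_delta ('D_v f x)).
rewrite linear_sum; apply: eq_bigr => j _.
by rewrite linearZ /= (deriveE _ gd).
Qed.

Lemma Ck_on_comp V W n k (A : set V) (B : set 'rV[R]_n) (f : V -> 'rV[R]_n)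
    (g : 'rV[R]_n -> W) : open A -> (forall x, A x -> B (f x)) ->
  Ck_on k A f -> Ck_on k B g -> Ck_on k A (g \o f).
Proof.
move=> oA AB; elim: k g => [|k IH] g fC gC.
  move=> x Ax; apply: continuous_comp; [exact: fC|exact: gC _ (AB _ Ax)].
split=> [x Ax|v].
  by apply: differentiable_comp; [case: fC => + _; apply|case: gC => + _; apply; exact: AB].
apply: (@Ck_on_eq _ _ _ _
   (fun x => \sum_j ('D_v f x) 0 j *: ('D_(delta_mx 0 j) g \o f) x)) => //.
  move=> x Ax; rewrite -row_derive_comp //; first by case: fC => + _; apply.
  by case: gC => + _; apply; exact: AB.
apply: Ck_on_sum => // j; apply: Ck_on_scaler => //.
  apply: (@Ck_on_lin_comp _ _ _ _ _ _ (fun M : 'rV[R]_n => M 0 j)) => //.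
  - by move=> a u w; rewrite !mxE.
  - exact: coord_continuous.
  - by case: fC => _; apply.
by apply: (IH (fun y => 'D_(delta_mx 0 j) g y)); [exact: Ck_on_le|case: gC => _; exact].
Qed.

End Smooth.

Section SmoothOn.
Variable R : realType.
Implicit Types V W Z : normedModType R.

Lemma smooth_on_sub V W (A B : set V) (f : V -> W) :
  A `<=` B -> smooth_on B f -> smooth_on A f.
Proof. by move=> AB fB k; exact: Ck_on_sub AB (fB k). Qed.

Lemma smooth_on_eq V W (A : set V) (f g : V -> W) : open A ->
  (forall x, A x -> f x = g x) -> smooth_on A f -> smooth_on A g.
Proof. by move=> oA fg fA k; exact: Ck_on_eq oA fg (fA k). Qed.

Lemma smooth_on_local V W (A : set V) (f : V -> W) :
  (forall x, A x -> exists (B : set V) (g : V -> W),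
     [/\ open B, B x, smooth_on B g & forall y, B y -> f y = g y]) ->
  smooth_on A f.
Proof.
move=> loc k; apply: Ck_onP => x /loc [B [g [oB Bx gB fg]]].
apply: (@Ck_on_sub _ _ _ _ _ B); first by move=> _ ->.
by apply: (Ck_on_eq oB _ (gB k)) => y /fg ->.
Qed.

Lemma smooth_on_differentiable V W (A : set V) (f : V -> W) x :
  smooth_on A f -> A x -> differentiable f x.
Proof. by move=> fA Ax; case: (fA 1%N) => + _; apply. Qed.

Lemma smooth_on_continuous V W (A : set V) (f : V -> W) x :
  smooth_on A f -> A x -> {for x, continuous f}.
Proof. by move=> fA Ax; exact: fA 0%N x Ax. Qed.

Lemma smooth_on_cst V W (A : set V) (c : W) : smooth_on A (fun=> c).
Proof. by move=> k; exact: Ck_on_cst. Qed.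

Lemma smooth_on_lin V W (A : set V) (L : V -> W) :
  linear L -> continuous L -> smooth_on A L.
Proof. by move=> lL cL k; exact: Ck_on_lin. Qed.

Lemma smooth_on_id V (A : set V) : smooth_on A (@id V).
Proof. by apply: smooth_on_lin => // x; exact: cvg_id. Qed.

Lemma smooth_on_lin_comp V W Z (A : set V) (f : V -> W) (L : W -> Z) : open A ->
  linear L -> continuous L -> smooth_on A f -> smooth_on A (L \o f).
Proof. by move=> oA lL cL fA k; exact: Ck_on_lin_comp. Qed.

Lemma smooth_on_comp_lin V W Z (A : set V) (B : set W) (L : V -> W) (f : W -> Z) :
  open A -> linear L -> continuous L -> (forall x, A x -> B (L x)) ->
  smooth_on B f -> smooth_on A (f \o L).
Proof. by move=> oA lL cL AB fA k; exact: Ck_on_comp_lin lL cL AB (fA k). Qed.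

Lemma smooth_on_pair V W Z (A : set V) (f : V -> W) (g : V -> Z) : open A ->
  smooth_on A f -> smooth_on A g -> smooth_on A (fun x => (f x, g x)).
Proof. by move=> oA fA gA k; exact: Ck_on_pair. Qed.

Lemma smooth_on_fst V W Z (A : set V) (f : V -> W * Z) : open A ->
  smooth_on A f -> smooth_on A (fun x => (f x).1).
Proof.
move=> oA; apply: (@smooth_on_lin_comp _ _ _ _ _ (fst : W * Z -> W)) => //.
by move=> x; exact: cvg_fst.
Qed.

Lemma smooth_on_snd V W Z (A : set V) (f : V -> W * Z) : open A ->
  smooth_on A f -> smooth_on A (fun x => (f x).2).
Proof.
move=> oA; apply: (@smooth_on_lin_comp _ _ _ _ _ (snd : W * Z -> Z)) => //.
by move=> x; exact: cvg_snd.
Qed.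

Lemma smooth_on_add V W (A : set V) (f g : V -> W) : open A ->
  smooth_on A f -> smooth_on A g -> smooth_on A (fun x => f x + g x).
Proof. by move=> oA fA gA k; exact: Ck_on_add. Qed.

Lemma smooth_on_scale V W (A : set V) c (f : V -> W) : open A ->
  smooth_on A f -> smooth_on A (fun x => c *: f x).
Proof. by move=> oA fA k; exact: Ck_on_scale. Qed.

Lemma smooth_on_scaler V W (A : set V) (f : V -> R) (g : V -> W) : open A ->
  smooth_on A f -> smooth_on A g -> smooth_on A (fun x => f x *: g x).
Proof. by move=> oA fA gA k; exact: Ck_on_scaler. Qed.

Lemma smooth_on_mulmx V (A : set V) m n p (f : V -> 'M[R]_(m, n))
    (g : V -> 'M[R]_(n, p)) : open A ->
  smooth_on A f -> smooth_on A g -> smooth_on A (fun x => f x *m g x).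
Proof. by move=> oA fA gA k; exact: Ck_on_mulmx. Qed.

Lemma smooth_on_mx V (A : set V) m n (f : V -> 'M[R]_(m, n)) : open A ->
  (forall i j, smooth_on A (fun x => f x i j : R)) -> smooth_on A f.
Proof. by move=> oA fA k; apply: Ck_on_mx => // i j; exact: fA. Qed.

Lemma smooth_on_mxlin V m n p q (A : set V) (L : 'M[R]_(m, n) -> 'M[R]_(p, q))
    (f : V -> 'M[R]_(m, n)) : open A -> linear L ->
  smooth_on A f -> smooth_on A (fun x => L (f x)).
Proof.
move=> oA lL; apply: (@smooth_on_lin_comp _ _ _ _ _ L) => //.
exact: mx_linear_continuous.
Qed.

Lemma smooth_on_coord V m n (A : set V) (f : V -> 'M[R]_(m, n)) i j : open A ->
  smooth_on A f -> smooth_on A (fun x => f x i j : R).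
Proof.
move=> oA; apply: (@smooth_on_lin_comp _ _ _ _ _ (fun M : 'M[R]_(m, n) => M i j)) => //.
  by move=> a u v; rewrite !mxE.
exact: coord_continuous.
Qed.

Lemma smooth_on_comp V W n (A : set V) (B : set 'rV[R]_n) (f : V -> 'rV[R]_n)
    (g : 'rV[R]_n -> W) : open A -> (forall x, A x -> B (f x)) ->
  smooth_on A f -> smooth_on B g -> smooth_on A (fun x => g (f x)).
Proof. by move=> oA AB fA gB k; exact: (@Ck_on_comp _ _ _ _ _ _ B). Qed.

Lemma smooth_on_derive V W (A : set V) (f : V -> W) v :
  smooth_on A f -> smooth_on A (fun x => 'D_v f x).
Proof. by move=> fA k; case: (fA k.+1) => _; exact. Qed.

End SmoothOn.

(* Failed unifications between instances of ['J] unfold ['d] down to its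
   choice operator and diverge, hence this sealed copy; the definitions [tc],
   [bmat], [bA], [bphi], [bP], [bD] and [symb] below are sealed for the same
   reason. *)
HB.lock Definition jac (R : realType) (m n : nat) (f : 'rV[R]_m -> 'rV[R]_n)
  (a : 'rV[R]_m) : 'M[R]_(m, n) := 'J f a.

Section Jacobian.
Variable R : realType.

Lemma derive_jac m n (f : 'rV[R]_m -> 'rV[R]_n) a v :
  differentiable f a -> 'D_v f a = v *m jac f a.
Proof. by move=> fd; rewrite deriveEjacobian // jac.unlock. Qed.

Lemma jac_is_diff m n (f : 'rV[R]_m -> 'rV[R]_n) a :
  differentiable f a -> is_diff a f (fun v => v *m jac f a).
Proof. by move=> fd; apply: is_diff_of => // v; rewrite derive_jac. Qed.

Lemma jac_eq m n (f : 'rV[R]_m -> 'rV[R]_n) a B :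
  is_diff a f (fun v => v *m B) -> jac f a = B.
Proof.
move=> fd; have [df _] := fd; apply/row_matrixP => i; rewrite !rowE.
by rewrite -(derive_jac _ df) (is_diff_derive _ fd).
Qed.

Lemma jac_comp m n p (f : 'rV[R]_m -> 'rV[R]_n) (g : 'rV[R]_n -> 'rV[R]_p) a :
  differentiable f a -> differentiable g (f a) ->
  jac (g \o f) a = jac f a *m jac g (f a).
Proof.
move=> fd gd; apply: jac_eq.
have := is_diff_comp (jac_is_diff fd) (jac_is_diff gd).
by move/is_diff_eq; apply; apply/funext => v /=; rewrite mulmxA.
Qed.

Lemma near_jac m n (f g : 'rV[R]_m -> 'rV[R]_n) a :
  (\forall x \near a, f x = g x) -> differentiable f a -> jac f a = jac g a.
Proof.
by move=> fg fd; rewrite (jac_eq (near_is_diff fg (jac_is_diff fd))).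
Qed.

Lemma jac_id n (a : 'rV[R]_n) : jac (@id 'rV[R]_n) a = 1%:M.
Proof.
apply: jac_eq; have := is_diff_id a.
by move/is_diff_eq; apply; apply/funext => v; rewrite mulmx1.
Qed.

Lemma smooth_on_jac m n (A : set 'rV[R]_m) (f : 'rV[R]_m -> 'rV[R]_n) :
  open A -> smooth_on A f -> smooth_on A (fun x => jac f x).
Proof.
move=> oA fA; apply: smooth_on_mx => // i j.
apply: (@smooth_on_eq _ _ _ _ (fun x => ('D_(delta_mx 0 i) f x) 0 j)) => //.
  move=> x Ax; rewrite derive_jac; last exact: smooth_on_differentiable fA Ax.
  by rewrite -rowE mxE.
by apply: smooth_on_coord => //; exact: smooth_on_derive.
Qed.

End Jacobian.

(** * Local diffeomorphisms of the coordinate space *)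

Section LocalDiffeo.
Variables (R : realType) (n : nat).
Implicit Types (A B : set 'rV[R]_n) (f g : 'rV[R]_n -> 'rV[R]_n).

(** The inverse is part of the data, so restrictions and compositions carry theirs explicitly. Off
    the image of [A] the values of [g] are arbitrary. *)
Definition local_diffeo A f g := [/\ open A, smooth_on A f, open (f @` A),
  smooth_on (f @` A) g & forall x, A x -> g (f x) = x].

Lemma open_preimage (T U : topologicalType) (A : set T) (f : T -> U) (B : set U) :
  open A -> (forall x, A x -> {for x, continuous f}) -> open B ->
  open (A `&` f @^-1` B).
Proof.
by move=> oA cf oB; apply: (continuous_inP f oA).1 => // x; rewrite inE; exact: cf.
Qed.

Lemma local_diffeo_sub A B f g : local_diffeo A f g -> open B -> B `<=` A ->
  local_diffeo B f g.
Proof.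
move=> [oA fA ofA gA gK] oB BA; have fBA : f @` B `<=` f @` A.
  by move=> _ [x Bx <-]; exists x => //; exact: BA.
split => //; [exact: smooth_on_sub BA fA| |exact: smooth_on_sub gA|].
  (* Openness of the image of [B]: it is the part of the open image of [A] that the continuous map
     [g] sends into [B]. *)
  rewrite (_ : _ @` _ = (f @` A) `&` g @^-1` B).
    by apply: open_preimage => // x; exact: smooth_on_continuous gA.
  apply/seteqP; split=> [_ [x Bx <-]|_ [[x Ax <-] /=]].
    by split; [exists x => //; exact: BA|rewrite /= gK //; exact: BA].
  by rewrite gK // => Bx; exists x.
by move=> x /BA; exact: gK.
Qed.

Lemma local_diffeo_comp A B f g f' g' :
  local_diffeo A f g -> local_diffeo B f' g' ->
  local_diffeo (A `&` f @^-1` B) (f' \o f) (g \o g').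
Proof.
move=> fA f'B; have [oA sA _ _ _] := fA; have [oB s'B _ _ _] := f'B.
have oC : open (A `&` f @^-1` B).
  by apply: open_preimage => // x; exact: smooth_on_continuous sA.
have fC : local_diffeo (A `&` f @^-1` B) f g.
  by apply: (local_diffeo_sub fA oC) => x [].
have [_ sC ofC gC gK] := fC.
have CB : f @` (A `&` f @^-1` B) `<=` B by move=> _ [x [_ Bfx] <-].
have [_ sD ofD gD gK'] := local_diffeo_sub f'B ofC CB.
have imE : (f' \o f) @` (A `&` f @^-1` B) = f' @` (f @` (A `&` f @^-1` B)).
  by rewrite image_comp.
split => //.
- by apply: (smooth_on_comp (B := B)) => // x [].
- by rewrite imE.
- rewrite imE; apply: (smooth_on_comp (B := f @` (A `&` f @^-1` B))) => //.
  by move=> _ [y Cy <-]; rewrite gK'.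
- by move=> x Cx /=; rewrite gK' ?gK //; exists x.
Qed.

Definition affine_map (a b : 'rV[R]_n) (B : 'M[R]_n) (u : 'rV[R]_n) :=
  b + (u - a) *m B.

Lemma affine_map_is_diff a b (B : 'M[R]_n) x :
  is_diff x (affine_map a b B) (fun v => v *m B).
Proof.
have lB : linear (fun v : 'rV[R]_n => v *m B).
  by move=> c u v; rewrite mulmxDl scalemxAl.
have -> : affine_map a b B = (fun v => v *m B) + cst (b - a *m B).
  by apply/funext => u; rewrite /affine_map !fctE /= mulmxBl addrCA addrC -addrA.
have := is_diffD (linear_is_diff x lB (mx_linear_continuous lB)) (is_diff_cst (b - a *m B) x).
by move/is_diff_eq; apply; apply/funext => v; rewrite !fctE addr0.
Qed.

Lemma smooth_on_affine_map a b (B : 'M[R]_n) A : smooth_on A (affine_map a b B).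
Proof.
apply: (@smooth_on_sub _ _ _ _ setT) => // k.
case: k => [|k].
  move=> x _; apply: differentiable_continuous.
  by case: (affine_map_is_diff a b B x).
apply: (@Ck_on_is_diff _ _ _ _ _ _ (fun _ v => v *m B)); first exact: openT.
  by move=> x _; exact: affine_map_is_diff.
by move=> v; exact: Ck_on_cst.
Qed.

Lemma affine_map_local_diffeo a b (B : 'M[R]_n) : B \in unitmx ->
  local_diffeo setT (affine_map a b B) (affine_map b a (invmx B)).
Proof.
move=> uB; have imT : affine_map a b B @` setT = setT.
  apply/seteqP; split => // w _; exists (affine_map b a (invmx B) w) => //.
  by rewrite /affine_map addrAC subrr add0r mulmxKV // addrC subrK.
split; rewrite ?imT; try exact: openT; try exact: smooth_on_affine_map.
by move=> x _; rewrite /affine_map addrAC subrr add0r mulmxK // addrC subrK.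
Qed.

End LocalDiffeo.

(** * Charts of the manifold and of its frame groupoid *)

HB.lock Definition tc (R : realType) (n : nat) (M : manifold R n)
  (c : chart R n M) (x : M) : 'M[R]_n := tcoord c x.

(** The field [bmx] refers to the preferred charts of the end points, which do not vary
    continuously. Only after conversion to fixed charts can it be differentiated along a
    bisection. *)
HB.lock Definition bmat (R : realType) (n : nat) (M : manifold R n)
  (c d : chart R n M) (xi : B1 M) : 'M[R]_n :=
  invmx (tc c (bsrc xi)) *m bmx xi *m tc d (btgt xi).

Section Charts.
Variables (R : realType) (n : nat) (M : manifold R n).
Implicit Types (c d : chart R n M) (x y : M) (O : set M).

Definition cimg c : set 'rV[R]_n := cmap c @` cdom c.

Definition trans c d : 'rV[R]_n -> 'rV[R]_n := cmap d \o cinv c.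

Lemma chart_atP x : charts M (chart_at x) /\ cdom (chart_at x) x.
Proof. exact: projT2 (cid (m_cover x)). Qed.

Lemma cimg_cmap c x : cdom c x -> cimg c (cmap c x).
Proof. by move=> cx; exists x. Qed.

Lemma cinv_dom c u : charts M c -> cimg c u -> cdom c (cinv c u).
Proof. by move=> Mc [x cx <-]; rewrite m_cmapK. Qed.

Lemma cinvK c u : charts M c -> cimg c u -> cmap c (cinv c u) = u.
Proof. by move=> Mc [x cx <-]; rewrite m_cmapK. Qed.

Lemma chart_imageE c O : charts M c ->
  cmap c @` (cdom c `&` O) = cimg c `&` cinv c @^-1` O.
Proof.
move=> Mc; apply/seteqP; split=> [_ [x [cx Ox] <-]|u [[x cx <-] /=]].
  by split; [exact: cimg_cmap|rewrite /= m_cmapK].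
by rewrite m_cmapK // => Ox; exists x.
Qed.

Lemma open_chart_image c O : charts M c -> open O ->
  open (cmap c @` (cdom c `&` O)).
Proof.
move=> Mc oO; rewrite chart_imageE //.
by apply: open_preimage; [exact: m_img_open|move=> u cu; exact: m_cinv_cont|].
Qed.

Lemma open_chart_preimage c (B : set 'rV[R]_n) : charts M c -> open B ->
  open (cdom c `&` cmap c @^-1` B).
Proof.
move=> Mc oB.
by apply: open_preimage; [exact: m_dom_open|move=> x cx; exact: m_cmap_cont|].
Qed.

Lemma near_cdom c x : charts M c -> cdom c x -> \forall z \near x, cdom c z.
Proof. by move=> Mc cx; apply: open_nbhs_nbhs; split => //; exact: m_dom_open. Qed.

Lemma near_cimg c x : charts M c -> cdom c x -> \forall u \near cmap c x, cimg c u.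
Proof.
by move=> Mc cx; apply: open_nbhs_nbhs; split; [exact: m_img_open|exact: cimg_cmap].
Qed.

Lemma near_cinv c x (P : M -> Prop) : charts M c -> cdom c x ->
  (\forall z \near x, P z) -> \forall u \near cmap c x, P (cinv c u).
Proof.
move=> Mc cx Px.
have h : cinv c @ cmap c x --> cinv c (cmap c x) by exact: m_cinv_cont Mc _ (cimg_cmap cx).
by rewrite m_cmapK // in h; exact: h Px.
Qed.

Lemma near_cmap c x (P : 'rV[R]_n -> Prop) : charts M c -> cdom c x ->
  (\forall u \near cmap c x, P u) -> \forall z \near x, P (cmap c z).
Proof. by move=> Mc cx Px; exact: m_cmap_cont cx _ Px. Qed.

Lemma trans_cmap c d x : charts M c -> cdom c x -> trans c d (cmap c x) = cmap d x.
Proof. by move=> Mc cx; rewrite /trans /= m_cmapK. Qed.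

Lemma smooth_trans c d : charts M c -> charts M d ->
  smooth_on (cmap c @` (cdom c `&` cdom d)) (trans c d).
Proof. exact: m_compat. Qed.

Lemma trans_differentiable c d x : charts M c -> charts M d ->
  cdom c x -> cdom d x -> differentiable (trans c d) (cmap c x).
Proof.
move=> Mc Md cx dx; apply: smooth_on_differentiable (smooth_trans Mc Md) _.
by exists x.
Qed.

Lemma near_trans c d (e : M -> 'rV[R]_n) x : charts M c -> charts M d ->
  cdom c x -> cdom d x ->
  \forall u \near cmap c x, (e \o cinv d) (trans c d u) = (e \o cinv c) u.
Proof.
move=> Mc Md cx dx; have := near_cinv Mc cx (near_cdom Md dx).
by apply: filterS => u du; rewrite /trans /= m_cmapK.
Qed.

Lemma jac_trans_comp c d e x : charts M c -> charts M d -> charts M e ->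
  cdom c x -> cdom d x -> cdom e x ->
  jac (trans c e) (cmap c x) = jac (trans c d) (cmap c x) *m jac (trans d e) (cmap d x).
Proof.
move=> Mc Md Me cx dx ex.
have dcd := trans_differentiable Mc Md cx dx.
have := trans_differentiable Md Me dx ex; rewrite -(trans_cmap d Mc cx) => dde.
rewrite -(jac_comp dcd dde); apply/esym/near_jac; first exact: near_trans.
exact: differentiable_comp.
Qed.

Lemma jac_trans_id c x : charts M c -> cdom c x ->
  jac (trans c c) (cmap c x) = 1%:M.
Proof.
move=> Mc cx; rewrite -[RHS](jac_id (cmap c x)).
apply: near_jac; last exact: trans_differentiable.
by apply: filterS (near_cimg Mc cx) => u; exact: cinvK.
Qed.

Lemma jac_transK c d x : charts M c -> charts M d -> cdom c x -> cdom d x ->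
  jac (trans c d) (cmap c x) *m jac (trans d c) (cmap d x) = 1%:M.
Proof. by move=> Mc Md cx dx; rewrite -jac_trans_comp // jac_trans_id. Qed.

Lemma tcE c x : tc c x = jac (trans (chart_at x) c) (cmap (chart_at x) x).
Proof. by rewrite tc.unlock jac.unlock. Qed.

Lemma tc_trans c d x : charts M c -> charts M d -> cdom c x -> cdom d x ->
  tc d x = tc c x *m jac (trans c d) (cmap c x).
Proof.
move=> Mc Md cx dx; have [Mx xx] := chart_atP x.
by rewrite !tcE (jac_trans_comp Mx Mc Md xx cx dx).
Qed.

Lemma tc_chart_at x : tc (chart_at x) x = 1%:M.
Proof. by have [Mx xx] := chart_atP x; rewrite tcE jac_trans_id. Qed.

Lemma tc_unit c x : charts M c -> cdom c x -> tc c x \in unitmx.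
Proof.
move=> Mc cx; have [Mx xx] := chart_atP x.
by have [h _] := mulmx1_unit (jac_transK Mx Mc xx cx); rewrite tcE.
Qed.

Lemma invmx_tc c d x : charts M c -> charts M d -> cdom c x -> cdom d x ->
  invmx (tc d x) = jac (trans d c) (cmap d x) *m invmx (tc c x).
Proof.
move=> Mc Md cx dx.
have E : tc d x *m (jac (trans d c) (cmap d x) *m invmx (tc c x)) = 1%:M.
  by rewrite mulmxA -(tc_trans Md Mc dx cx) (mulmxV (tc_unit Mc cx)).
by rewrite -[RHS](mulKmx (tc_unit Md dx)) E mulmx1.
Qed.

Lemma B1coordE c d (xi : B1 M) :
  B1coord c d xi = (cmap c (bsrc xi), cmap d (btgt xi), bmat c d xi).
Proof. by rewrite bmat.unlock !tc.unlock. Qed.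

(** The transition map of [B1atlas]. The inverse of the Jacobian of [trans c c'] is written as the
    Jacobian of [trans c' c] at the image point, so that the matrix part is a product of visibly
    smooth factors. *)
Definition B1trans c d c' d' (p : 'rV[R]_n * 'rV[R]_n * 'M[R]_n) :
    'rV[R]_n * 'rV[R]_n * 'M[R]_n :=
  (trans c c' p.1.1, trans d d' p.1.2,
   jac (trans c' c) (trans c c' p.1.1) *m p.2 *m jac (trans d d') p.1.2).

Lemma bmat_trans c d c' d' (xi : B1 M) :
  charts M c -> charts M d -> charts M c' -> charts M d' ->
  cdom c (bsrc xi) -> cdom d (btgt xi) -> cdom c' (bsrc xi) -> cdom d' (btgt xi) ->
  bmat c' d' xi = jac (trans c' c) (cmap c' (bsrc xi)) *m bmat c d xi *m
    jac (trans d d') (cmap d (btgt xi)).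
Proof.
move=> Mc Md Mc' Md' cx dy c'x d'y; rewrite bmat.unlock.
by rewrite (invmx_tc Mc Mc' cx c'x) (tc_trans Md Md' dy d'y) !mulmxA.
Qed.

Lemma B1coord_trans c d c' d' (xi : B1 M) :
  charts M c -> charts M d -> charts M c' -> charts M d' ->
  cdom c (bsrc xi) -> cdom d (btgt xi) -> cdom c' (bsrc xi) -> cdom d' (btgt xi) ->
  B1coord c' d' xi = B1trans c d c' d' (B1coord c d xi).
Proof.
move=> Mc Md Mc' Md' cx dy c'x d'y; rewrite /B1trans !B1coordE /=.
by rewrite (trans_cmap c' Mc cx) (trans_cmap d' Md dy) (bmat_trans Mc Md).
Qed.

Definition B1trans_dom c d c' d' : set ('rV[R]_n * 'rV[R]_n * 'M[R]_n) :=
  [set p | (cmap c @` (cdom c `&` cdom c')) p.1.1 /\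
           (cmap d @` (cdom d `&` cdom d')) p.1.2].

Lemma open_fst (T U : topologicalType) (A : set T) : open A ->
  open [set p : T * U | A p.1].
Proof. by move=> oA; apply: open_comp => // p _; exact: cvg_fst. Qed.

Lemma open_snd (T U : topologicalType) (A : set U) : open A ->
  open [set p : T * U | A p.2].
Proof. by move=> oA; apply: open_comp => // p _; exact: cvg_snd. Qed.

Lemma open_B1dom (A B : set 'rV[R]_n) : open A -> open B ->
  open [set p : 'rV[R]_n * 'rV[R]_n * 'M[R]_n | A p.1.1 /\ B p.1.2].
Proof.
move=> oA oB; apply: openI.
  exact: (@open_fst _ _ [set q : 'rV[R]_n * 'rV[R]_n | A q.1] (open_fst oA)).
exact: (@open_fst _ _ [set q : 'rV[R]_n * 'rV[R]_n | B q.2] (open_snd oB)).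
Qed.

Lemma smooth_B1trans c d c' d' :
  charts M c -> charts M d -> charts M c' -> charts M d' ->
  smooth_on (B1trans_dom c d c' d') (B1trans c d c' d').
Proof.
move=> Mc Md Mc' Md'.
have occ' := open_chart_image Mc (m_dom_open Mc').
have odd' := open_chart_image Md (m_dom_open Md').
have oc'c := open_chart_image Mc' (m_dom_open Mc).
have oD := open_B1dom occ' odd'.
have sid : smooth_on (B1trans_dom c d c' d') id by exact: smooth_on_id.
have s11 : smooth_on (B1trans_dom c d c' d') (fun p => p.1.1).
  by do 2!apply: smooth_on_fst => //.
have s12 : smooth_on (B1trans_dom c d c' d') (fun p => p.1.2).
  by apply: smooth_on_snd => //; apply: smooth_on_fst.
have s2 : smooth_on (B1trans_dom c d c' d') (fun p => p.2) by apply: smooth_on_snd.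
have st : smooth_on (B1trans_dom c d c' d') (fun p => trans c c' p.1.1).
  by apply: smooth_on_comp (smooth_trans Mc Mc') => // p [].
apply: smooth_on_pair => //; first apply: smooth_on_pair => //.
  by apply: smooth_on_comp (smooth_trans Md Md') => // p [].
apply: smooth_on_mulmx => //; first apply: smooth_on_mulmx => //.
  apply: smooth_on_comp (smooth_on_jac oc'c (smooth_trans Mc' Mc)) => //.
  by move=> p [[x [cx c'x] <-] _]; rewrite trans_cmap //; exists x.
by apply: smooth_on_comp (smooth_on_jac odd' (smooth_trans Md Md')) => // p [].
Qed.

Section SmoothAt.
Variables (T' : Type) (V' : normedModType R) (A' : atlas T' V') (f : M -> T').

Lemma smooth_at_loc c C' x : smooth_at (matlas M) A' f x ->
  charts M c -> A' C' -> cdom c x -> C'.1 (f x) ->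
  exists (B : set 'rV[R]_n) (F : 'rV[R]_n -> V'),
    [/\ open B, B (cmap c x), smooth_on B F, B `<=` cimg c &
      forall u, B u -> C'.1 (f (cinv c u)) /\ C'.2 (f (cinv c u)) = F u].
Proof.
move=> fx Mc AC' cx Cfx.
have [] := fx (cdom c, cmap c) C' _ AC' cx Cfx; first by exists c.
move=> W [F [oW Wx sF FE]].
exists (W `&` cimg c), F; split => //.
- by apply: openI => //; exact: m_img_open.
- by split => //; exact: cimg_cmap.
- exact: smooth_on_sub sF.
- move=> u [Wu cu]; have := FE (cinv c u); rewrite /= cinvK //; apply => //.
  exact: cinv_dom.
Qed.

Lemma smooth_at_near C' x : smooth_at (matlas M) A' f x -> A' C' -> C'.1 (f x) ->
  \forall z \near x, C'.1 (f z).
Proof.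
move=> fx AC' Cfx; have [Mc cx] := chart_atP x.
have [B [F [oB Bx _ _ FE]]] := smooth_at_loc fx Mc AC' cx Cfx.
have nB : \forall z \near x, B (cmap (chart_at x) z).
  by apply: near_cmap => //; exact: open_nbhs_nbhs.
near=> z; rewrite -(@m_cmapK _ _ _ _ Mc z); last by near: z; exact: near_cdom.
by apply: (FE _ _).1; near: z.
Unshelve. all: by end_near. Qed.

Lemma smooth_at_smooth_on c C' (O : set M) :
  charts M c -> A' C' -> (forall x, O x -> smooth_at (matlas M) A' f x) ->
  (forall x, O x -> C'.1 (f x)) ->
  smooth_on (cmap c @` (cdom c `&` O)) (fun u => C'.2 (f (cinv c u))).
Proof.
move=> Mc AC' fO CO; apply: smooth_on_local => _ [x [cx Ox] <-].
have [B [F [oB Bx sF _ FE]]] := smooth_at_loc (fO x Ox) Mc AC' cx (CO x Ox).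
by exists B, F; split => // u /FE[].
Qed.

Lemma smooth_atI x :
  (forall c C', charts M c -> A' C' -> cdom c x -> C'.1 (f x) ->
    exists B : set 'rV[R]_n, [/\ open B, B (cmap c x),
      smooth_on B (fun u => C'.2 (f (cinv c u))) &
      forall u, B u -> cimg c u -> C'.1 (f (cinv c u))]) ->
  smooth_at (matlas M) A' f x.
Proof.
move=> loc _ C' [c Mc <-] AC' /= cx Cfx.
have [B [oB Bx sB CB]] := loc c C' Mc AC' cx Cfx.
exists B, (fun u => C'.2 (f (cinv c u))); split => // z cz Bz.
by have := CB _ Bz (cimg_cmap cz); rewrite m_cmapK.
Qed.

End SmoothAt.
End Charts.

(** * First-order germs of bisections in charts *)

Lemma mulmx_is_diff (R : realType) (V : normedModType R) m n p
    (f df : V -> 'M[R]_(m, n)) (g dg : V -> 'M[R]_(n, p)) x :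
  is_diff x f df -> is_diff x g dg ->
  is_diff x (fun y => f y *m g y) (fun v => df v *m g x + f x *m dg v).
Proof.
apply: (@bilinear_is_diff _ _ _ _ _ (@mulmx R m n p)).
- by move=> u a v w; rewrite linearP.
- by move=> u a v w; rewrite mulmxDl scalemxAl.
- exact: mulmx_continuous.
Qed.

Lemma derive_linear (R : realType) (V W : normedModType R) (f : V -> W) x :
  differentiable f x -> linear (fun v => 'D_v f x).
Proof. by move=> fd a u v; rewrite !deriveE // linearP. Qed.

(* In charts [c] and [d], a bisection is the pair of its base map [bphi] and of
   its matrix part [bA]; its 1-jet at [x] has derivatives [bP] and [bD]. *)
HB.lock Definition bA (R : realType) (n : nat) (M : manifold R n)
  (c d : chart R n M) (b : M -> B1 M) (u : 'rV[R]_n) : 'M[R]_n :=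
  bmat c d (b (cinv c u)).

HB.lock Definition bphi (R : realType) (n : nat) (M : manifold R n)
  (c d : chart R n M) (b : M -> B1 M) (u : 'rV[R]_n) : 'rV[R]_n :=
  cmap d (bbase b (cinv c u)).

HB.lock Definition bP (R : realType) (n : nat) (M : manifold R n)
  (c d : chart R n M) (b : M -> B1 M) (x : M) : 'M[R]_n :=
  jac (bphi c d b) (cmap c x).

HB.lock Definition bD (R : realType) (n : nat) (M : manifold R n)
  (c d : chart R n M) (b : M -> B1 M) (x : M) (v : 'rV[R]_n) : 'M[R]_n :=
  'D_v (bA c d b) (cmap c x).

Section Germs.
Variables (R : realType) (n : nat) (M : manifold R n).
Implicit Types (c d e : chart R n M) (x y : M) (b : M -> B1 M).

(** What first-order calculus at [x] uses of a bisection. It is stated for functions because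
    [bisection_mul] returns a bare function, with no domain or inverse attached. *)
Definition bregular x b :=
  (\forall z \near x, bsrc (b z) = z) /\
  forall d, charts M d -> cdom d (bbase b x) ->
    (\forall z \near x, cdom d (bbase b z)) /\
    forall c, charts M c -> cdom c x ->
      differentiable (bphi c d b) (cmap c x) /\
      differentiable (bA c d b) (cmap c x).

Lemma bPE c d b x : bP c d b x = jac (bphi c d b) (cmap c x).
Proof. by rewrite bP.unlock. Qed.

Lemma bDE c d b x v : bD c d b x v = 'D_v (bA c d b) (cmap c x).
Proof. by rewrite bD.unlock. Qed.

Lemma bphi_cmap c d b x : charts M c -> cdom c x ->
  bphi c d b (cmap c x) = cmap d (bbase b x).
Proof. by move=> Mc cx; rewrite bphi.unlock m_cmapK. Qed.

Lemma bA_cmap c d b x : charts M c -> cdom c x ->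
  bA c d b (cmap c x) = bmat c d (b x).
Proof. by move=> Mc cx; rewrite bA.unlock m_cmapK. Qed.

Section Regular.
Variables (c d : chart R n M) (x : M) (b : M -> B1 M).
Hypotheses (Mc : charts M c) (Md : charts M d).
Hypotheses (rb : bregular x b) (cx : cdom c x) (dy : cdom d (bbase b x)).

Lemma bphi_is_diff : is_diff (cmap c x) (bphi c d b) (fun v => v *m bP c d b x).
Proof.
have [_ /(_ c Mc cx) [dphi _]] := rb.2 d Md dy.
by rewrite bPE; exact: jac_is_diff.
Qed.

Lemma bA_is_diff : is_diff (cmap c x) (bA c d b) (bD c d b x).
Proof.
have [_ /(_ c Mc cx) [_ dA]] := rb.2 d Md dy.
by apply: is_diff_of => // v; rewrite bDE.
Qed.

Lemma bD_linear : linear (bD c d b x).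
Proof.
have [_ /(_ c Mc cx) [_ dA]] := rb.2 d Md dy.
by rewrite bD.unlock; exact: derive_linear.
Qed.

Lemma bDZ a v : bD c d b x (a *: v) = a *: bD c d b x v.
Proof.
have b0 : bD c d b x 0 = 0.
  by have := bD_linear (-1) 0 0; rewrite scaler0 addr0 scaleN1r addNr.
by have := bD_linear a v 0; rewrite b0 !addr0.
Qed.

Lemma bcoord_is_diff :
  is_diff (cmap c x) (B1coord c d \o b \o cinv c)
    (fun v => (v, v *m bP c d b x, bD c d b x v)).
Proof.
have := is_diff_pair (is_diff_pair (is_diff_id (cmap c x)) bphi_is_diff) bA_is_diff.
apply: near_is_diff.
have n1 := near_cinv Mc cx rb.1; have n2 := near_cimg Mc cx.
near=> u.
have Eu : bsrc (b (cinv c u)) = cinv c u by near: u.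
have cu : cimg c u by near: u.
by rewrite /= B1coordE Eu cinvK // bphi.unlock bA.unlock.
Unshelve. all: by end_near. Qed.

(** Continuity of the base map at [x], deduced in charts from the differentiability of [bphi]. *)
Lemma near_bphi (P : M -> Prop) :
  (\forall z \near bbase b x, P z) -> \forall u \near cmap c x, P (bbase b (cinv c u)).
Proof.
move=> nP; have [ndy /(_ c Mc cx) [dphi _]] := rb.2 d Md dy.
have := differentiable_continuous dphi.
rewrite /prop_for /continuous_at bphi_cmap // => cphi.
have := cphi _ (near_cinv Md dy nP).
have n1 := near_cinv Mc cx ndy => n2.
near=> u.
have du : cdom d (bbase b (cinv c u)) by near: u.
rewrite -(m_cmapK Md du).
have : P (cinv d (bphi c d b u)) by near: u.
by rewrite bphi.unlock.
Unshelve. all: by end_near. Qed.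

End Regular.

(** By [bcoord_is_diff] the differential compared in [same_jet1] has the identity as first
    component, and [bP] and [bD] as the other two. *)
Lemma same_jet1P x b b' : bregular x b -> bregular x b' ->
  let c := chart_at x in let d := chart_at (bbase b x) in
  same_jet1 x b b' <->
  [/\ b x = b' x, bP c d b x = bP c d b' x & bD c d b x = bD c d b' x].
Proof.
move=> rb rb' c d; have [Mc cx] := chart_atP x.
have [Md dy] := chart_atP (bbase b x).
have db := bcoord_is_diff Mc Md rb cx dy.
have E0 : b x = b' x -> cdom d (bbase b' x) by rewrite /bbase => <-.
split=> [[E1 E2]|[E1 EP ED]].
  have db' := bcoord_is_diff Mc Md rb' cx (E0 E1).
  have E v : (v, v *m bP c d b x, bD c d b x v) = (v, v *m bP c d b' x, bD c d b' x v).
    have [_ e1] := db; have [_ e2] := db'.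
    have E3 := etrans (esym e1) (etrans E2 e2).
    exact (congr1 (fun f => f v) E3).
  split; first exact: E1.
    apply/row_matrixP => i; rewrite !rowE.
    exact (congr1 (fun p => p.1.2) (E (delta_mx 0 i))).
  by apply/funext => v; exact (congr1 snd (E v)).
have db' := bcoord_is_diff Mc Md rb' cx (E0 E1).
rewrite -EP -ED in db'; have [_ e1] := db; have [_ e2] := db'.
by split; [exact: E1|exact: etrans e1 (esym e2)].
Qed.

Section Transition.
Variables (c d c' d' : chart R n M) (x : M) (b : M -> B1 M).
Hypotheses (Mc : charts M c) (Md : charts M d).
Hypotheses (Mc' : charts M c') (Md' : charts M d').
Hypotheses (rb : bregular x b) (cx : cdom c x) (dy : cdom d (bbase b x)).
Hypotheses (cx' : cdom c' x) (dy' : cdom d' (bbase b x)).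

Let J1 := jac (trans c' c) (cmap c' x).
Let J2 := jac (trans d d') (cmap d (bbase b x)).

Let trans_is_diff : is_diff (cmap c' x) (trans c' c) (fun v => v *m J1).
Proof. by apply: jac_is_diff; exact: trans_differentiable. Qed.

Let bphi_trans_is_diff :
  is_diff (cmap c' x) (bphi c d b \o trans c' c) (fun v => v *m J1 *m bP c d b x).
Proof.
have h := bphi_is_diff Mc Md rb cx dy; rewrite -(trans_cmap c Mc' cx') in h.
exact: is_diff_comp trans_is_diff h.
Qed.

Lemma bP_trans : bP c' d' b x = J1 *m bP c d b x *m J2.
Proof.
rewrite [LHS]bPE; apply: jac_eq.
have h : is_diff ((bphi c d b \o trans c' c) (cmap c' x)) (trans d d') (fun w => w *m J2).
  rewrite /= trans_cmap // bphi_cmap //.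
  by apply: jac_is_diff; exact: trans_differentiable.
have H0 := is_diff_comp bphi_trans_is_diff h.
have H : is_diff (cmap c' x) (trans d d' \o (bphi c d b \o trans c' c))
    (fun v => v *m (J1 *m bP c d b x *m J2)).
  by apply: is_diff_eq H0 _; apply/funext => v; rewrite /= !mulmxA.
apply: near_is_diff H.
have [n1 _] := rb.2 d Md dy; have n2 := near_cinv Mc' cx' n1.
have n3 := near_cinv Mc' cx' (near_cdom Mc cx).
near=> u.
have cu : cdom c (cinv c' u) by near: u.
have du : cdom d (bbase b (cinv c' u)) by near: u.
by rewrite bphi.unlock /trans /= (m_cmapK Mc cu) (m_cmapK Md du).
Unshelve. all: by end_near. Qed.

(** The product rule for [bmat_trans] along the base map. The outer terms contain second derivatives
    of the coordinate changes, but involve the bisection only through its value and [bP]. *)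
Lemma bD_trans v : bD c' d' b x v =
  'D_v (fun u => jac (trans c' c) u) (cmap c' x) *m bmat c d (b x) *m J2 +
  J1 *m bD c d b x (v *m J1) *m J2 +
  J1 *m bmat c d (b x) *m
    'D_(v *m J1 *m bP c d b x) (fun u => jac (trans d d') u) (cmap d (bbase b x)).
Proof.
have oc := open_chart_image Mc' (m_dom_open Mc).
have od := open_chart_image Md (m_dom_open Md').
have d1 : is_diff (cmap c' x) (fun u => jac (trans c' c) u)
    (fun v => 'D_v (fun u => jac (trans c' c) u) (cmap c' x)).
  apply: is_diff_of => //.
  apply: smooth_on_differentiable (smooth_on_jac oc (smooth_trans Mc' Mc)) _.
  by exists x.
have d2 : is_diff (cmap d (bbase b x)) (fun u => jac (trans d d') u)
    (fun v => 'D_v (fun u => jac (trans d d') u) (cmap d (bbase b x))).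
  apply: is_diff_of => //.
  apply: smooth_on_differentiable (smooth_on_jac od (smooth_trans Md Md')) _.
  by exists (bbase b x).
have d3 : is_diff (cmap c' x) (bA c d b \o trans c' c) (fun v => bD c d b x (v *m J1)).
  have h := bA_is_diff Mc Md rb cx dy; rewrite -(trans_cmap c Mc' cx') in h.
  exact: is_diff_comp trans_is_diff h.
have d4 : is_diff (cmap c' x) ((fun u => jac (trans d d') u) \o (bphi c d b \o trans c' c))
   (fun v => 'D_(v *m J1 *m bP c d b x) (fun u => jac (trans d d') u) (cmap d (bbase b x))).
  rewrite -(bphi_cmap d b Mc cx) -(trans_cmap c Mc' cx') in d2 *.
  exact: is_diff_comp bphi_trans_is_diff d2.
have D := mulmx_is_diff (mulmx_is_diff d1 d3) d4.
have -> : bD c' d' b x v = 'D_v (fun u => jac (trans c' c) u *m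
   (bA c d b \o trans c' c) u *m jac (trans d d') ((bphi c d b \o trans c' c) u)) (cmap c' x).
  rewrite bDE; apply: near_eq_derive.
  have [n1 _] := rb.2 d Md dy; have n2 := near_cinv Mc' cx' n1.
  have [n1' _] := rb.2 d' Md' dy'; have n2' := near_cinv Mc' cx' n1'.
  have n3 := near_cinv Mc' cx' (near_cdom Mc cx).
  have n3' := near_cinv Mc' cx' (near_cdom Mc' cx').
  have n4 := near_cinv Mc' cx' rb.1; have n5 := near_cimg Mc' cx'.
  near=> u; rewrite bA.unlock bphi.unlock /trans /=.
  have su : bsrc (b (cinv c' u)) = cinv c' u by near: u.
  have cu : cdom c (cinv c' u) by near: u.
  have c'u : cdom c' (cinv c' u) by near: u.
  have du : cdom d (bbase b (cinv c' u)) by near: u.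
  have d'u : cdom d' (bbase b (cinv c' u)) by near: u.
  have uE : cmap c' (cinv c' u) = u by apply: cinvK => //; near: u.
  rewrite (m_cmapK Mc cu).
  by rewrite (@bmat_trans _ _ _ c d c' d' _ Mc Md Mc' Md' _ du _ d'u) su ?uE.
rewrite (is_diff_derive v D) /= trans_cmap // bphi_cmap // bA_cmap //.
by rewrite mulmxDl.
Unshelve. all: by end_near. Qed.

End Transition.

(** [bP_trans] and [bD_trans] express the new derivatives through the value, [bP] and [bD], so
    equality in the preferred charts passes to all charts. *)
Lemma same_jet1_charts x b b' c d : bregular x b -> bregular x b' ->
  charts M c -> charts M d -> cdom c x -> cdom d (bbase b x) ->
  same_jet1 x b b' ->
  [/\ b x = b' x, bP c d b x = bP c d b' x & bD c d b x = bD c d b' x].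
Proof.
move=> rb rb' Mc Md cx dy /(same_jet1P rb rb') [E EP ED].
have Eb : bbase b' x = bbase b x by rewrite /bbase E.
have [Mx xx] := chart_atP x; have [My yy] := chart_atP (bbase b x).
have yy' : cdom (chart_at (bbase b x)) (bbase b' x) by rewrite Eb.
have dy' : cdom d (bbase b' x) by rewrite Eb.
split => //.
  rewrite (bP_trans Mx My Mc Md rb xx yy cx dy).
  by rewrite (bP_trans Mx My Mc Md rb' xx yy' cx dy') EP Eb.
apply/funext => v; rewrite (bD_trans Mx My Mc Md rb xx yy cx dy).
by rewrite (bD_trans Mx My Mc Md rb' xx yy' cx dy') EP ED Eb E.
Qed.

Section Product.
Variables (c d e : chart R n M) (x : M) (b b' : M -> B1 M).
Hypotheses (Mc : charts M c) (Md : charts M d) (Me : charts M e).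
Let y := bbase b x.
Hypotheses (rb : bregular x b) (rb' : bregular y b').
Hypotheses (cx : cdom c x) (dy : cdom d y) (ez : cdom e (bbase b' y)).

Lemma bphi_mul_is_diff : is_diff (cmap c x) (bphi c e (bisection_mul b' b))
  (fun v => v *m bP c d b x *m bP d e b' y).
Proof.
have h := bphi_is_diff Md Me rb' dy ez; rewrite -(bphi_cmap d b Mc cx) in h.
have := is_diff_comp (bphi_is_diff Mc Md rb cx dy) h; apply: near_is_diff.
have [n1 _] := rb.2 d Md dy; have n2 := near_cinv Mc cx n1.
near=> u.
have du : cdom d (bbase b (cinv c u)) by near: u.
by rewrite bphi.unlock /= (m_cmapK Md du).
Unshelve. all: by end_near. Qed.

Lemma bA_mul_is_diff : is_diff (cmap c x) (bA c e (bisection_mul b' b))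
  (fun v => bD c d b x v *m bmat d e (b' y) +
            bmat c d (b x) *m bD d e b' y (v *m bP c d b x)).
Proof.
have h := bA_is_diff Md Me rb' dy ez; rewrite -(bphi_cmap d b Mc cx) in h.
have h1 := is_diff_comp (bphi_is_diff Mc Md rb cx dy) h.
have := mulmx_is_diff (bA_is_diff Mc Md rb cx dy) h1.
rewrite /= bphi_cmap // !bA_cmap //; apply: near_is_diff.
have [n1 _] := rb.2 d Md dy; have n2 := near_cinv Mc cx n1.
have n3 := near_bphi Mc Md rb cx dy rb'.1.
near=> u; rewrite bA.unlock bphi.unlock.
have du : cdom d (bbase b (cinv c u)) by near: u.
have su : bsrc (b' (bbase b (cinv c u))) = bbase b (cinv c u) by near: u.
(* The component change [tc d] at the intermediate point meets its inverse, which leaves the product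
   of the two coordinate matrices. *)
rewrite m_cmapK // bmat.unlock /= su /bbase !mulmxA mulmxK; last first.
  by have := tc_unit Md du.
by [].
Unshelve. all: by end_near. Qed.

Lemma bP_mul : bP c e (bisection_mul b' b) x = bP c d b x *m bP d e b' y.
Proof.
rewrite bPE; apply: jac_eq; move/is_diff_eq: bphi_mul_is_diff; apply.
by apply/funext => v; rewrite mulmxA.
Qed.

Lemma bD_mul v : bD c e (bisection_mul b' b) x v =
  bD c d b x v *m bmat d e (b' y) + bmat c d (b x) *m bD d e b' y (v *m bP c d b x).
Proof. by rewrite [LHS]bDE (is_diff_derive v bA_mul_is_diff). Qed.

End Product.

Lemma bregular_mul x b b' : bregular x b -> bregular (bbase b x) b' ->
  bregular x (bisection_mul b' b).
Proof.
move=> rb rb'; have [My yy] := chart_atP (bbase b x).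
split; first exact: rb.1.
move=> e Me ez; split.
  have [Mx xx] := chart_atP x.
  have [n1 _] := rb'.2 e Me ez.
  have n2 := near_cmap Mx xx (near_bphi Mx My rb xx yy n1).
  have n3 := near_cdom Mx xx.
  near=> z; rewrite -(@m_cmapK _ _ _ _ Mx z); last by near: z.
  by near: z.
move=> c Mc cx; split.
  by case: (bphi_mul_is_diff Mc My Me rb rb' cx yy ez).
by case: (bA_mul_is_diff Mc My Me rb rb' cx yy ez).
Unshelve. all: by end_near. Qed.

End Germs.

(** * Bisections and jets *)

Section Bisections.
Variables (R : realType) (n : nat) (M : manifold R n).
Implicit Types (c d e : chart R n M) (x y : M) (b : bisection M).

Definition B1box c d : set (B1 M) * (B1 M -> 'rV[R]_n * 'rV[R]_n * 'M[R]_n) :=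
  ([set xi : B1 M | cdom c (bsrc xi) /\ cdom d (btgt xi)], B1coord c d).

Lemma B1boxP c d : charts M c -> charts M d -> B1atlas M (B1box c d).
Proof. by move=> Mc Md; exists c, d. Qed.

Definition bset d b : set M := [set x | bdom b x /\ cdom d (bbase b x)].

Lemma bis_near d b x : charts M d -> bset d b x -> \forall z \near x, bset d b z.
Proof.
move=> Md [bx dy]; have [Mx xx] := chart_atP x.
have h : (B1box (chart_at x) d).1 (b x) by rewrite /= (bis_src bx).
have := smooth_at_near (bis_smooth bx) (B1boxP Mx Md) h.
have : \forall z \near x, bdom b z by apply: open_nbhs_nbhs; split => //; exact: bis_open.
by apply: filterS2 => z bz [_ dz]; split.
Qed.

Lemma open_bset d b : charts M d -> open (bset d b).
Proof. by move=> Md; rewrite openE => x bx; exact: bis_near. Qed.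

Definition bcdom c d b := cmap c @` (cdom c `&` bset d b).

Lemma open_bcdom c d b : charts M c -> charts M d -> open (bcdom c d b).
Proof. by move=> Mc Md; apply: open_chart_image => //; exact: open_bset. Qed.

Lemma smooth_bcoord c d b : charts M c -> charts M d ->
  smooth_on (bcdom c d b) (fun u => B1coord c d (b (cinv c u))).
Proof.
move=> Mc Md; have := @smooth_at_smooth_on _ _ _ _ _ _ b c (B1box c d)
  (cdom c `&` bset d b) Mc (B1boxP Mc Md).
rewrite /bcdom setIA setIid; apply => x [cx [bx dy]]; first exact: bis_smooth.
by rewrite /= (bis_src bx).
Qed.

Lemma smooth_bphi c d b : charts M c -> charts M d ->
  smooth_on (bcdom c d b) (bphi c d b).
Proof.
move=> Mc Md; have oD : open (bcdom c d b) by exact: open_bcdom.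
have := smooth_on_snd oD (smooth_on_fst oD (@smooth_bcoord c d b Mc Md)).
by apply: smooth_on_eq => // u _; rewrite B1coordE bphi.unlock.
Qed.

Lemma smooth_bA c d b : charts M c -> charts M d ->
  smooth_on (bcdom c d b) (bA c d b).
Proof.
move=> Mc Md; have oD : open (bcdom c d b) by exact: open_bcdom.
have := smooth_on_snd oD (@smooth_bcoord c d b Mc Md).
by apply: smooth_on_eq => // u _; rewrite B1coordE bA.unlock.
Qed.

Lemma bregular_bis b x : bdom b x -> bregular x b.
Proof.
move=> bx; split.
  have : \forall z \near x, bdom b z by apply: open_nbhs_nbhs; split => //; exact: bis_open.
  by apply: filterS => z; exact: bis_src.
move=> d Md dy; split; first by apply: filterS (bis_near Md (conj bx dy)) => z [].
move=> c Mc cx; have Dx : bcdom c d b (cmap c x) by exists x.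
by split; [exact: smooth_on_differentiable (@smooth_bphi c d b Mc Md) Dx
          |exact: smooth_on_differentiable (@smooth_bA c d b Mc Md) Dx].
Qed.

Lemma matlasP c : charts M c -> matlas M (cdom c, cmap c).
Proof. by exists c. Qed.

Lemma bphi_local_diffeo c d b : charts M c -> charts M d ->
  exists g, local_diffeo (bcdom c d b) (bphi c d b) g.
Proof.
move=> Mc Md; have [g [gK sg]] := bis_diffeo b.
(* The image points whose preimage lies in the domain of [c]. This set is open because [smooth_at]
   keeps the values of [g] at nearby points inside that chart. *)
pose Oy : set M := (bbase b @` bdom b) `&` [set y | cdom c (g y)].
have sgy y : Oy y -> smooth_at (matlas M) (matlas M) g y by move=> [by_ _]; exact: sg.
have oOy : open Oy.
  rewrite openE => y Oyy; have [by_ cgy] := Oyy.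
  have h : \forall z \near y, (bbase b @` bdom b) z.
    by apply: open_nbhs_nbhs; split => //; exact: bis_img_open.
  have := smooth_at_near (sgy y Oyy) (matlasP Mc) cgy.
  by rewrite /interior; move: h; apply: filterS2 => z bz cz; split.
exists (fun w => cmap c (g (cinv d w))).
have imE : bphi c d b @` bcdom c d b = cmap d @` (cdom d `&` Oy).
  apply/seteqP; split=> [_ [_ [x [cx [bx dy]] <-] <-]|_ [y [dy [[x bx xy] cy]] <-]].
    rewrite bphi_cmap //; exists (bbase b x) => //; split => //.
    by split; [exists x|rewrite /= gK].
  rewrite -xy /= gK // in cy; rewrite -xy in dy *.
  by exists (cmap c x); [exists x|rewrite bphi_cmap].
split.
- exact: open_bcdom.
- exact: smooth_bphi.
- by rewrite imE; exact: open_chart_image.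
- rewrite imE.
  apply: (@smooth_at_smooth_on _ _ _ _ _ _ g d (cdom c, cmap c) Oy Md (matlasP Mc)) => //.
  by move=> y [].
- by move=> _ [x [cx [bx dy]] <-]; rewrite bphi_cmap // m_cmapK // gK.
Qed.

End Bisections.

Section Jets.
Variables (R : realType) (n : nat) (M : manifold R n).
Implicit Types (c d e : chart R n M) (x y : M) (b : bisection M).

Lemma same_jet1_sym x (b b' : M -> B1 M) : bregular x b -> bregular x b' ->
  same_jet1 x b b' -> same_jet1 x b' b.
Proof.
move=> rb rb' /(same_jet1P rb rb') [E EP ED]; apply/(same_jet1P rb' rb).
have Eb : bbase b' x = bbase b x by rewrite /bbase E.
by rewrite Eb; split.
Qed.

Lemma same_jet1_trans x (b b' b'' : M -> B1 M) :
  bregular x b -> bregular x b' -> bregular x b'' ->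
  same_jet1 x b b' -> same_jet1 x b' b'' -> same_jet1 x b b''.
Proof.
move=> rb rb' rb'' /(same_jet1P rb rb') [E EP ED] /(same_jet1P rb' rb'') [E' EP' ED'].
have Eb : bbase b' x = bbase b x by rewrite /bbase E.
rewrite Eb in EP' ED'; apply/(same_jet1P rb rb''); split.
- by rewrite E.
- by rewrite EP.
- by rewrite ED.
Qed.

Lemma jrep_dom (J : jet M) : bdom (jrep J) (jsrc J).
Proof. exact: (projT2 (cid (jet_ex J))).1. Qed.

Lemma jrep_class (J : jet M) : jcls J = jet1_class (jsrc J) (jrep J).
Proof. exact: (projT2 (cid (jet_ex J))).2. Qed.

Lemma jet1_class_refl x b : bdom b x -> jet1_class x b b.
Proof. by move=> bx; split. Qed.

Lemma jclsP (J : jet M) b :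
  jcls J b <-> bdom b (jsrc J) /\ same_jet1 (jsrc J) (jrep J) b.
Proof. by rewrite jrep_class. Qed.

Lemma jet1_class_eq x b b' : bdom b x -> bdom b' x -> same_jet1 x b b' ->
  jet1_class x b = jet1_class x b'.
Proof.
move=> bx b'x bb'; have rb := bregular_bis bx; have rb' := bregular_bis b'x.
apply/seteqP; split=> b'' [b''x E]; (split; first exact: b''x).
  exact: same_jet1_trans rb' rb (bregular_bis b''x) (same_jet1_sym rb rb' bb') E.
exact: same_jet1_trans rb rb' (bregular_bis b''x) bb' E.
Qed.

Lemma jet_eq (J J' : jet M) : jsrc J = jsrc J' -> jcls J = jcls J' -> J = J'.
Proof.
case: J J' => [x C h] [x' C' h'] /= E1 E2; subst x' C'.
by rewrite (Prop_irrelevance h h').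
Qed.

Lemma shjet_eq (J J' : shjet M) : shval J = shval J' -> J = J'.
Proof.
case: J J' => [J h] [J' h'] /= E; subst J'.
by rewrite (Prop_irrelevance h h').
Qed.

Lemma jp_src (J : jet M) : bsrc (jp J) = jsrc J.
Proof. exact: bis_src (jrep_dom J). Qed.

Lemma jp_tgt (J : jet M) : btgt (jp J) = jtgt J.
Proof. by []. Qed.

Lemma jrep_regular (J : jet M) : bregular (jsrc J) (jrep J).
Proof. exact: bregular_bis (jrep_dom J). Qed.

Lemma sh_bP_chart_at (J : jet M) :
  bP (chart_at (jsrc J)) (chart_at (jtgt J)) (jrep J) (jsrc J) = jpstar J.
Proof. by rewrite bPE jac.unlock bphi.unlock. Qed.

Lemma bmat_chart_at (xi : B1 M) :
  bmat (chart_at (bsrc xi)) (chart_at (btgt xi)) xi = bmx xi.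
Proof. by rewrite bmat.unlock !tc_chart_at invmx1 mulmx1 mul1mx. Qed.

(** The equality p = p_* is imposed in the preferred charts only; it holds in all charts because
    both sides change by the same two Jacobians. *)
Lemma sh_bP (J : shjet M) c d : charts M c -> charts M d ->
  cdom c (jsrc J) -> cdom d (jtgt J) ->
  bP c d (jrep J) (jsrc J) = bmat c d (jp J).
Proof.
move=> Mc Md cx dy.
have [Mx xx] := chart_atP (jsrc J); have [My yy] := chart_atP (jtgt J).
have sx := jp_src J.
rewrite (bP_trans Mx My Mc Md (jrep_regular J) xx yy cx dy).
rewrite (@bmat_trans _ _ _ (chart_at (jsrc J)) (chart_at (jtgt J)) c d) ?sx //.
by rewrite sh_bP_chart_at -sh_eq -bmat_chart_at sx.
Qed.

(** Of the three data of a jet, [bP] is already fixed by [jp] through [sh_bP]. *)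
Lemma shjet_ext (J J' : shjet M) : jp J = jp J' ->
  bD (chart_at (jsrc J)) (chart_at (jtgt J)) (jrep J) (jsrc J) =
  bD (chart_at (jsrc J)) (chart_at (jtgt J)) (jrep J') (jsrc J) -> J = J'.
Proof.
move=> Ep ED; have Es : jsrc J = jsrc J' by rewrite -!jp_src Ep.
have Et : jtgt J = jtgt J' by rewrite -!jp_tgt Ep.
have [Mx xx] := chart_atP (jsrc J); have [My yy] := chart_atP (jtgt J).
have xx' := xx; have yy' := yy; rewrite {2}Es in xx'; rewrite {2}Et in yy'.
have dJ := jrep_dom J; have dJ' := jrep_dom J'; rewrite -Es in dJ'.
have rJ := jrep_regular J; have rJ' := jrep_regular J'; rewrite -Es in rJ'.
apply: shjet_eq; apply: (jet_eq Es); rewrite !jrep_class -Es.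
apply: (jet1_class_eq dJ dJ'); apply/(same_jet1P rJ rJ'); split; last exact: ED.
  by have := Ep; rewrite /jp -Es.
have E1 := sh_bP Mx My xx yy.
have E2 := sh_bP Mx My xx' yy'; rewrite -Es -Ep in E2.
exact: etrans E1 (esym E2).
Qed.

Section MkJet.
Variables (x : M) (b : bisection M) (bx : bdom b x).

Definition mkjet : jet M :=
  @Jet R n M x (jet1_class x b) (ex_intro _ b (conj bx erefl)).

(** [jrep] returns some member of the class of [b], not [b] itself; the lemmas on [mkjet] recover
    what does not depend on that choice. *)
Lemma mkjet_jrep : same_jet1 x (jrep mkjet) b.
Proof. by have /jclsP[] : jcls mkjet b by exact: jet1_class_refl. Qed.

Lemma mkjet_jp : jp mkjet = b x.
Proof. by case: mkjet_jrep. Qed.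

Lemma mkjet_charts c d : charts M c -> charts M d -> cdom c x ->
  cdom d (bbase b x) ->
  bP c d (jrep mkjet) x = bP c d b x /\ bD c d (jrep mkjet) x = bD c d b x.
Proof.
move=> Mc Md cx dy.
have E : bbase (jrep mkjet) x = bbase b x by rewrite /bbase; case: mkjet_jrep => ->.
rewrite -E in dy.
by have [] := same_jet1_charts (jrep_regular mkjet) (bregular_bis bx) Mc Md cx dy mkjet_jrep.
Qed.

End MkJet.

End Jets.

(** * Construction of bisections from coordinate data *)

Section MkBisection.
Variables (R : realType) (n : nat) (M : manifold R n).

(* Off the invertible matrices the junk value is a copy of [- 1]. *)
Definition mkB1 (x y : M) (A : 'M[R]_n) : B1 M :=
  match pselect (A \in unitmx) with
  | left h => MkB1 x y h
  | right _ => MkB1 x y (unitmxN1 R n)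
  end.

Lemma mkB1_src x y A : bsrc (mkB1 x y A) = x.
Proof. by rewrite /mkB1; case: pselect. Qed.

Lemma mkB1_tgt x y A : btgt (mkB1 x y A) = y.
Proof. by rewrite /mkB1; case: pselect. Qed.

Lemma mkB1_mx x y A : A \in unitmx -> bmx (mkB1 x y A) = A.
Proof. by rewrite /mkB1; case: pselect. Qed.

Lemma B1_eq (xi eta : B1 M) : bsrc xi = bsrc eta -> btgt xi = btgt eta ->
  bmx xi = bmx eta -> xi = eta.
Proof.
case: xi eta => [x y A h] [x' y' A' h'] /= -> -> E; subst A'.
by rewrite (bool_irrelevance h h').
Qed.

Variables (c d : chart R n M) (W : set 'rV[R]_n).
Variables (f g : 'rV[R]_n -> 'rV[R]_n) (A : 'rV[R]_n -> 'M[R]_n).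
Hypotheses (Mc : charts M c) (Md : charts M d) (fg : local_diffeo W f g).
Hypotheses (Wc : W `<=` cimg c) (fWd : f @` W `<=` cimg d).
Hypotheses (sA : smooth_on W A) (uA : forall u, W u -> A u \in unitmx).

Let dom : set M := cdom c `&` cmap c @^-1` W.
Let base (z : M) : M := cinv d (f (cmap c z)).
(** The matrix is [A] converted from the charts [c] and [d] back to the preferred charts, so that
    [bmat] returns [A]. *)
Let bis (z : M) : B1 M :=
  mkB1 z (base z) (tc c z *m A (cmap c z) *m invmx (tc d (base z))).

Let base_dom z : dom z -> cdom d (base z).
Proof. by move=> [cz Wz]; apply: cinv_dom => //; apply: fWd; exists (cmap c z). Qed.

Let cmap_base z : dom z -> cmap d (base z) = f (cmap c z).
Proof. by move=> [cz Wz]; apply: cinvK => //; apply: fWd; exists (cmap c z). Qed.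

Let open_dom : open dom.
Proof. by apply: open_chart_preimage => //; case: fg. Qed.

Let bbase_bis z : bbase bis z = base z.
Proof. exact: mkB1_tgt. Qed.

Let bis_srcE z : bsrc (bis z) = z.
Proof. exact: mkB1_src. Qed.

Let bmat_bis z : dom z -> bmat c d (bis z) = A (cmap c z).
Proof.
move=> dz; have [cz Wz] := dz; have tu := tc_unit Mc cz.
have tu' := tc_unit Md (base_dom dz).
have u1 : tc c z *m A (cmap c z) *m invmx (tc d (base z)) \in unitmx.
  by rewrite !unitmx_mul tu (uA Wz) unitmx_inv tu'.
rewrite bmat.unlock mkB1_mx // bis_srcE (mkB1_tgt z).
by rewrite -[tc c z *m _ *m _]mulmxA mulKmx // mulmxKV.
Qed.

(** The part of [dom] where [c1] and [d1] apply as well. The iterated preimages make openness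
    immediate; [dom2E] gives the usable form. *)
Let dom2 (c1 d1 : chart R n M) : set M :=
  cdom c1 `&` (cdom c `&` cmap c @^-1`
    (W `&` f @^-1` (cmap d @` (cdom d `&` cdom d1)))).

Let open_dom2 c1 d1 : charts M c1 -> charts M d1 -> open (dom2 c1 d1).
Proof.
move=> Mc1 Md1; apply: openI; first exact: m_dom_open.
apply: open_chart_preimage => //; have [oW sf _ _ _] := fg.
apply: open_preimage => //; first by move=> u; exact: smooth_on_continuous.
by apply: open_chart_image => //; exact: m_dom_open.
Qed.

Let dom2P c1 d1 z : dom z -> cdom c1 z -> cdom d1 (base z) -> dom2 c1 d1 z.
Proof.
move=> dz c1z d1z; have [cz Wz] := dz; split => //; split => //; split => //.
by exists (base z); rewrite ?cmap_base //; split => //; exact: base_dom.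
Qed.

Let dom2E c1 d1 z : dom2 c1 d1 z -> [/\ dom z, cdom c1 z & cdom d1 (base z)].
Proof.
move=> [c1z [cz [Wz [y [dy d1y] yE]]]]; split => //.
by rewrite /base -yE m_cmapK.
Qed.

Let bis_smooth_at x : dom x -> smooth_at (matlas M) (B1atlas M) bis x.
Proof.
move=> dx; apply: smooth_atI => c' _ Mc' [c1 [d1 [Mc1 Md1 ->]]] c'x /=.
rewrite bis_srcE mkB1_tgt => -[c1x d1x].
have o2 := open_dom2 Mc1 Md1; have [oW sf ofW sg gK] := fg.
have oB : open (cmap c' @` (cdom c' `&` dom2 c1 d1)) by exact: open_chart_image.
have strans : forall e, charts M e -> (forall z, dom2 c1 d1 z -> cdom e z) ->
    smooth_on (cmap c' @` (cdom c' `&` dom2 c1 d1)) (trans c' e).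
  move=> e Me De; apply: smooth_on_sub (smooth_trans Mc' Me).
  by move=> _ [z [c'z Dz] <-]; exists z => //; split => //; exact: De.
have st1 := strans c1 Mc1 (fun z Dz => let: And3 _ h _ := dom2E Dz in h).
have st : smooth_on (cmap c' @` (cdom c' `&` dom2 c1 d1)) (trans c' c).
  by apply: strans => // z /dom2E[[]].
have sf' : smooth_on (cmap c' @` (cdom c' `&` dom2 c1 d1)) (fun u => f (trans c' c u)).
  apply: smooth_on_comp st sf => // _ [z [c'z /dom2E[[_ Wz] _ _]] <-].
  by rewrite trans_cmap.
have fD : forall u, (cmap c' @` (cdom c' `&` dom2 c1 d1)) u ->
    (cmap d @` (cdom d `&` cdom d1)) (f (trans c' c u)).
  move=> _ [z [c'z /dom2E[dz _ d1z]] <-]; rewrite trans_cmap // -cmap_base //.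
  by exists (base z) => //; split => //; exact: base_dom.
exists (cmap c' @` (cdom c' `&` dom2 c1 d1)); split => //.
- by exists x => //; split => //; exact: dom2P.
- apply: (@smooth_on_eq _ _ _ _ (fun u => (trans c' c1 u, trans d d1 (f (trans c' c u)),
    jac (trans c1 c) (trans c' c1 u) *m A (trans c' c u) *m
    jac (trans d d1) (f (trans c' c u))))) => //.
    move=> _ [z [c'z Dz] <-]; have [dz c1z d1z] := dom2E Dz; have [cz Wz] := dz.
    rewrite (m_cmapK Mc' c'z) B1coordE !trans_cmap // bis_srcE.
    have dz' : cdom d (btgt (bis z)) by rewrite mkB1_tgt; exact: base_dom.
    have d1z' : cdom d1 (btgt (bis z)) by rewrite mkB1_tgt.
    have cz' : cdom c (bsrc (bis z)) by rewrite bis_srcE.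
    have c1z' : cdom c1 (bsrc (bis z)) by rewrite bis_srcE.
    rewrite (bmat_trans Mc Md Mc1 Md1 cz' dz' c1z' d1z') bmat_bis // bis_srcE mkB1_tgt.
    by rewrite cmap_base // -(trans_cmap d1 Md (base_dom dz)) cmap_base.
  apply: smooth_on_pair => //; first apply: smooth_on_pair => //.
    by apply: smooth_on_comp (smooth_trans Md Md1).
  apply: smooth_on_mulmx => //; first apply: smooth_on_mulmx => //.
  + have oc := open_chart_image Mc1 (m_dom_open Mc).
    apply: smooth_on_comp (smooth_on_jac oc (smooth_trans Mc1 Mc)) => //.
    move=> _ [z [c'z /dom2E[[cz _] c1z _]] <-].
    by rewrite trans_cmap //; exists z.
  + apply: smooth_on_comp st sA => // _ [z [c'z /dom2E[[_ Wz] _ _]] <-].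
    by rewrite trans_cmap.
  + have od := open_chart_image Md (m_dom_open Md1).
    by apply: smooth_on_comp (smooth_on_jac od (smooth_trans Md Md1)).
- move=> _ [z [c'z Dz] <-] _; have [dz c1z d1z] := dom2E Dz.
  by rewrite m_cmapK // bis_srcE mkB1_tgt.
Qed.

Let bbase_image : bbase bis @` dom = cdom d `&` cmap d @^-1` (f @` W).
Proof.
apply/seteqP; split=> [_ [z dz <-]|y [dy [u Wu uy]]].
  rewrite bbase_bis; split; first exact: base_dom.
  by rewrite /= cmap_base //; exists (cmap c z) => //; case: dz.
have cu := Wc Wu; exists (cinv c u).
  by split; [exact: cinv_dom|rewrite /= cinvK].
by rewrite bbase_bis /base cinvK // uy m_cmapK.
Qed.

Let bis_img : open (bbase bis @` dom).
Proof. by rewrite bbase_image; apply: open_chart_preimage => //; case: fg. Qed.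

Let bis_inv : exists h : M -> M, (forall x, dom x -> h (bbase bis x) = x) /\
  (forall y, (bbase bis @` dom) y -> smooth_at (matlas M) (matlas M) h y).
Proof.
have [oW sf ofW sg gK] := fg.
exists (fun y => cinv c (g (cmap d y))); split.
  move=> z dz; have [cz Wz] := dz.
  by rewrite bbase_bis cmap_base // gK // m_cmapK.
rewrite bbase_image => y [dy fy].
apply: smooth_atI => d1 _ Md1 [c1 Mc1 <-] d1y /= c1y.
pose D := cdom d `&` cmap d @^-1` (f @` W `&` g @^-1` (cmap c @` (cdom c `&` cdom c1))).
have oD : open D.
  apply: open_chart_preimage => //; apply: open_preimage => //.
    by move=> u; exact: smooth_on_continuous.
  by apply: open_chart_image => //; exact: m_dom_open.
have oB : open (cmap d1 @` (cdom d1 `&` D)) by exact: open_chart_image.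
exists (cmap d1 @` (cdom d1 `&` D)); split => //.
- exists y => //; split => //; split => //; split => //.
  have [u Wu uy] := fy; rewrite /= -uy gK //.
  have cu := Wc Wu; exists (cinv c u); rewrite ?cinvK //; split; first exact: cinv_dom.
  by rewrite /= -uy gK in c1y.
- apply: (@smooth_on_eq _ _ _ _ (fun u => trans c c1 (g (trans d1 d u)))) => //.
  apply: smooth_on_comp (smooth_trans Mc Mc1) => //.
    by move=> _ [z [d1z [dz [_ gz]]] <-]; rewrite trans_cmap.
  apply: (smooth_on_comp (B := f @` W)) => //.
    by move=> _ [z [d1z [dz [fz _]]] <-]; rewrite trans_cmap.
  apply: smooth_on_sub (smooth_trans Md1 Md).
  by move=> _ [z [d1z [dz _]] <-]; exists z.
- move=> _ [z [d1z [dz [_ [w [cw c1w] wz]]]] <-] _.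
  by rewrite m_cmapK // -wz m_cmapK.
Qed.

Lemma mkbis : exists b : bisection M,
  [/\ bdom b = cdom c `&` cmap c @^-1` W,
      (forall z, bdom b z -> cdom d (bbase b z)),
      (forall u, W u -> bphi c d b u = f u) &
      (forall u, W u -> bA c d b u = A u)].
Proof.
exists (@Bisection R n M dom bis open_dom (fun z _ => bis_srcE z) bis_smooth_at
  bis_img bis_inv).
have dW u : W u -> dom (cinv c u).
  by move=> Wu; have cu := Wc Wu; split; [exact: cinv_dom|rewrite /= cinvK].
split => //= [z dz|u Wu|u Wu]; first by rewrite bbase_bis; exact: base_dom.
  by rewrite bphi.unlock bbase_bis cmap_base; [rewrite cinvK //; exact: Wc|exact: dW].
by rewrite bA.unlock bmat_bis; [rewrite cinvK //; exact: Wc|exact: dW].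
Qed.

End MkBisection.

Section Construction.
Variables (R : realType) (n : nat) (M : manifold R n).
Implicit Types (c d e : chart R n M) (x y : M) (b : bisection M).

Lemma bmat_unit c d (xi : B1 M) : charts M c -> charts M d ->
  cdom c (bsrc xi) -> cdom d (btgt xi) -> bmat c d xi \in unitmx.
Proof.
move=> Mc Md cx dy; rewrite bmat.unlock !unitmx_mul unitmx_inv.
by rewrite (tc_unit Mc cx) (tc_unit Md dy) bmx_unit.
Qed.

Lemma bmat_neg c x : charts M c -> cdom c x -> bmat c c (B1neg x) = - 1%:M.
Proof.
move=> Mc cx; rewrite bmat.unlock /= mulmxN mulmx1 mulNmx mulVmx //.
exact: tc_unit.
Qed.

Lemma bcdomP c d b u : charts M c -> bcdom c d b u ->
  [/\ cdom c (cinv c u), bdom b (cinv c u), cdom d (bbase b (cinv c u)) & cimg c u].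
Proof.
by move=> Mc [x [cx [bx dx]] <-]; rewrite m_cmapK //; split => //; exists x.
Qed.

Lemma bA_unit c d b u : charts M c -> charts M d -> bcdom c d b u ->
  bA c d b u \in unitmx.
Proof.
move=> Mc Md /(bcdomP Mc) [cu bu du _]; rewrite bA.unlock.
by apply: bmat_unit => //; rewrite (bis_src bu).
Qed.

(** Holonomy on a whole domain and relative to the base map of [b] itself; in this form it is
    inherited by the composition in [symmetric_bisection]. *)
Definition bholonomic b := forall z, bdom b z -> bmx (b z) = tmap (bbase b) z.

Lemma bholonomicP b z c d : charts M c -> charts M d -> bdom b z -> cdom c z ->
  cdom d (bbase b z) ->
  bmx (b z) = tmap (bbase b) z <-> bmat c d (b z) = bP c d b z.
Proof.
move=> Mc Md bz cz dz; have [Mx xx] := chart_atP z.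
have [My yy] := chart_atP (bbase b z); have rb := bregular_bis bz.
have sz := bis_src bz.
have e1 : bmat (chart_at z) (chart_at (bbase b z)) (b z) = bmx (b z).
  by rewrite -[RHS]bmat_chart_at sz.
have e2 : bP (chart_at z) (chart_at (bbase b z)) b z = tmap (bbase b) z.
  by rewrite bPE jac.unlock bphi.unlock.
have sx c' : cdom c' z -> cdom c' (bsrc (b z)) by rewrite sz.
split=> E.
  rewrite (bP_trans Mx My Mc Md rb xx yy cz dz) e2 -E -e1.
  by rewrite (bmat_trans Mx My Mc Md (sx _ xx) yy (sx _ cz) dz) sz.
rewrite -e1 -e2 (bP_trans Mc Md Mx My rb cz dz xx yy) -E.
by rewrite (bmat_trans Mc Md Mx My (sx _ cz) dz (sx _ xx) yy) sz.
Qed.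

Section Data.
Variables (x y : M) (B : 'M[R]_n) (uB : B \in unitmx).
Variables (bx by_ : bisection M).
Hypotheses (dx : bdom bx x) (dy : bdom by_ y).
Hypotheses (bxE : bx x = B1neg x) (byE : by_ y = B1neg y).
Let c := chart_at x.
Let d := chart_at y.
Let u0 := cmap c x.
Let v0 := cmap d y.
Hypothesis Px : bP c c bx x = - 1%:M.
Hypothesis Py : bP d d by_ y = - 1%:M.

Let Mc : charts M c. Proof. by case: (chart_atP x). Qed.
Let Md : charts M d. Proof. by case: (chart_atP y). Qed.
Let cx : cdom c x. Proof. by case: (chart_atP x). Qed.
Let dy' : cdom d y. Proof. by case: (chart_atP y). Qed.

Let half : 'M[R]_n := (2^-1)%:M.
Let two : 'M[R]_n := 2%:M.
Let two_unit : two \in unitmx.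
Proof. by rewrite unitmxE det_scalar unitfE expf_neq0. Qed.
Let half_unit : half \in unitmx.
Proof. by rewrite unitmxE det_scalar unitfE expf_neq0 // invr_eq0. Qed.

Let m := affine_map u0 u0 half.
Let k := affine_map u0 v0 B \o (bphi c c bx \o m).
Let f := affine_map v0 v0 two \o (bphi d d by_ \o k).

Let bxbase : bbase bx x = x. Proof. by rewrite /bbase bxE. Qed.
Let bybase : bbase by_ y = y. Proof. by rewrite /bbase byE. Qed.

Let phix : bphi c c bx u0 = u0.
Proof. by rewrite bphi_cmap // bxbase. Qed.
Let phiy : bphi d d by_ v0 = v0.
Proof. by rewrite bphi_cmap // bybase. Qed.

Let aff0 (a b : 'rV[R]_n) (C : 'M[R]_n) : affine_map a b C a = b.
Proof. by rewrite /affine_map subrr mul0mx addr0. Qed.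

Let m0 : m u0 = u0. Proof. exact: aff0. Qed.
Let k0 : k u0 = v0. Proof. by rewrite /k /= m0 phix aff0. Qed.
Let f0 : f u0 = v0. Proof. by rewrite /f /= k0 phiy aff0. Qed.

Let Dx : bcdom c c bx u0.
Proof. by exists x => //; split => //; split => //; rewrite bxbase. Qed.
Let Dy : bcdom d d by_ v0.
Proof. by exists y => //; split => //; split => //; rewrite bybase. Qed.

Let A u := bA c c bx (m u) *m B *m bA d d by_ (k u).

(** A common domain for all the composites. The last two intersections bring the image and the
    domain inside the charts, as [mkbis] requires. *)
Let fdata : exists (W : set 'rV[R]_n) g,
  [/\ local_diffeo W f g, W u0, forall u, W u -> bcdom c c bx (m u),
      forall u, W u -> bcdom d d by_ (k u) & W `<=` cimg c /\ f @` W `<=` cimg d].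
Proof.
have [gx lx] := @bphi_local_diffeo _ _ _ c c bx Mc Mc.
have [gy ly] := @bphi_local_diffeo _ _ _ d d by_ Md Md.
have l1 := local_diffeo_comp (affine_map_local_diffeo u0 u0 half_unit) lx.
have l2 := local_diffeo_comp l1 (affine_map_local_diffeo u0 v0 uB).
have l3 := local_diffeo_comp l2 ly.
have l4 := local_diffeo_comp l3 (affine_map_local_diffeo v0 v0 two_unit).
move: l4; set W := (X in local_diffeo X _ _); set g := (X in local_diffeo _ _ X) => l4.
have [oW sf _ _ _] := l4.
have oD : open (W `&` f @^-1` cimg d).
  apply: (open_preimage oW); last exact: (m_img_open Md).
  by move=> u; exact: smooth_on_continuous sf.
have oC : open (cimg c) by exact: m_img_open.
exists ((W `&` f @^-1` cimg d) `&` cimg c), g.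
have sub : (W `&` f @^-1` cimg d) `&` cimg c `<=` W by move=> u [[]].
split.
- by apply: local_diffeo_sub l4 _ sub; exact: openI.
- have Dm : bcdom c c bx (m u0) by rewrite m0.
  have Dk : bcdom d d by_ (k u0) by rewrite k0.
  have Df : cimg d (f u0) by rewrite f0; exact: cimg_cmap.
  have Dc := cimg_cmap cx.
  by do 6?split.
- by move=> u [[[[[[_ Dm] _] _] _] _] _].
- by move=> u [[[[_ Dk] _] _] _].
- by split=> [u []|_ [u [[_ ?] _] <-]].
Qed.

(* With [phi] and [A] the two parts of [bx] and [by_] in coordinates, [b] has
   base map [v0 + 2 (phi_y (k u) - v0)] and matrix part [A_x (m u) B A_y (k u)],
   where [m u] is the midpoint of [u0] and [u], and
   [k u = v0 + (phi_x (m u) - u0) B].  Halving and doubling the distances scales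
   the second derivatives of [phi_x] and [phi_y] by one half, while the matrix
   part remains the differential of the base map when it is so for [bx], [by_]. *)
Lemma symmetric_bisection : exists b : bisection M,
  [/\ bdom b x, bbase b x = y, bmat c d (b x) = B, bP c d b x = B &
     (forall v, bD c d b x v =
        2^-1 *: (B *m bD d d by_ y (v *m B) - bD c c bx x v *m B)) /\
     (bholonomic bx -> bholonomic by_ -> bholonomic b)].
Proof.
have [W [g [lW Wu0 Wx Wy [Wc fWd]]]] := fdata; have [oW sf _ _ _] := lW.
have sm : smooth_on W m by exact: smooth_on_affine_map.
have sk : smooth_on W k.
  apply: (@smooth_on_comp _ _ _ _ _ setT (bphi c c bx \o m) (affine_map u0 v0 B)) => //.
    exact: (smooth_on_comp oW Wx sm (smooth_bphi bx Mc Mc)).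
  exact: smooth_on_affine_map.
have sA : smooth_on W A.
  apply: smooth_on_mulmx => //; last exact: (smooth_on_comp oW Wy sk (smooth_bA by_ Md Md)).
  apply: smooth_on_mulmx => //; last exact: smooth_on_cst.
  exact: (smooth_on_comp oW Wx sm (smooth_bA bx Mc Mc)).
have uA u : W u -> A u \in unitmx.
  move=> Wu; rewrite !unitmx_mul uB (bA_unit Mc Mc (Wx _ Wu)).
  exact: bA_unit Md Md (Wy _ Wu).
have [b [domb bd bphiE bAE]] := mkbis Mc Md lW Wc fWd sA uA.
have bx0 : bdom b x by rewrite domb.
have nW : \forall u \near u0, W u by exact: open_nbhs_nbhs.
have mD u : is_diff u m (fun v => v *m half) by exact: affine_map_is_diff.
have kD u : W u -> is_diff u k (fun v => v *m half *m jac (bphi c c bx) (m u) *m B).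
  move=> Wu.
  have dphi : differentiable (bphi c c bx) (m u).
    exact: smooth_on_differentiable (smooth_bphi bx Mc Mc) (Wx _ Wu).
  have h := is_diff_comp (mD u) (jac_is_diff dphi).
  exact: is_diff_comp h (affine_map_is_diff _ _ _ _).
have fD u : W u -> is_diff u f (fun v =>
    v *m half *m jac (bphi c c bx) (m u) *m B *m jac (bphi d d by_) (k u) *m two).
  move=> Wu.
  have dphi : differentiable (bphi d d by_) (k u).
    exact: smooth_on_differentiable (smooth_bphi by_ Md Md) (Wy _ Wu).
  have h := is_diff_comp (kD u Wu) (jac_is_diff dphi).
  exact: is_diff_comp h (affine_map_is_diff _ _ _ _).
have jacf u : W u ->
    jac f u = jac (bphi c c bx) (m u) *m B *m jac (bphi d d by_) (k u).
  move=> Wu; have E : is_diff u f (fun v => v *m (half *m jac (bphi c c bx) (m u)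
      *m B *m jac (bphi d d by_) (k u) *m two)).
    by apply: is_diff_eq (fD u Wu) _; apply/funext => v; rewrite !mulmxA.
  (* The scalar matrices [half] and [two] cancel, so the Jacobian of [f] is built from those of the
     two base maps exactly as [A] is built from the two matrix parts. Holonomy is preserved for this
     reason. *)
  rewrite (jac_eq E) mul_mx_scalar mul_scalar_mx -!scalemxAl scalerA.
  by rewrite mulfV ?scale1r.
have jacb u : W u ->
    jac (bphi c d b) u = jac (bphi c c bx) (m u) *m B *m jac (bphi d d by_) (k u).
  move=> Wu; rewrite -jacf //; apply/esym/near_jac.
    have : \forall u \near u, W u by exact: open_nbhs_nbhs.
    by apply: filterS => z Wz; rewrite bphiE.
  exact: smooth_on_differentiable sf Wu.
have bb : bbase b x = y.
  have := bphiE _ Wu0; rewrite f0 bphi_cmap // => E.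
  by rewrite -(m_cmapK Md (bd _ bx0)) E m_cmapK.
have Ax : bA c c bx u0 = - 1%:M by rewrite bA_cmap // bxE bmat_neg.
have Ay : bA d d by_ v0 = - 1%:M by rewrite bA_cmap // byE bmat_neg.
exists b; split => //.
- by rewrite -bA_cmap // bAE // /A m0 k0 Ax Ay mulNmx mul1mx mulmxN mulmx1 opprK.
- rewrite bPE jacb // m0 k0 -/u0 -!bPE Px.
  by have := Py; rewrite bPE => ->; rewrite mulNmx mul1mx mulmxN mulmx1 opprK.
split=> [v|hx hy z bz].
  have -> : bD c d b x v = 'D_v A u0.
    rewrite bDE; apply: near_eq_derive; apply: filterS nW => u Wu; exact: bAE.
  have h1 := bA_is_diff Mc Mc (bregular_bis dx) cx.
  rewrite bxbase in h1; have {}h1 := h1 cx; rewrite -/u0 -m0 in h1.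
  have h2 := bA_is_diff Md Md (bregular_bis dy) dy'.
  rewrite bybase in h2; have {}h2 := h2 dy'; rewrite -/v0 -k0 in h2.
  have g1 := is_diff_comp (mD u0) h1; have g2 := is_diff_comp (kD u0 Wu0) h2.
  have gA := mulmx_is_diff (mulmx_is_diff g1 (is_diff_cst B u0)) g2.
  rewrite (is_diff_derive v gA) /= m0 k0 Ax Ay -/u0 -bPE Px.
  (* The derivative of [k] at [u0] along [v]: the 1/2 comes from [m], the sign from the hypothesis
     [Px]. *)
  have E : v *m half *m - 1%:M *m B = (- 2^-1) *: (v *m B).
    by rewrite mul_mx_scalar mulmxN mulmx1 mulNmx -scalemxAl scaleNr.
  have cx' : cdom c (bbase bx x) by rewrite bxbase.
  have dy'' : cdom d (bbase by_ y) by rewrite bybase.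
  rewrite E mul_mx_scalar (bDZ Mc Mc (bregular_bis dx) cx cx').
  rewrite (bDZ Md Md (bregular_bis dy) dy' dy'').
  rewrite mulmx0 addr0 mulmxN mulmx1 !mulNmx mul1mx -scalemxAl -scalemxAr.
  by rewrite scaleNr opprK scalerBr addrC.
have [cz Wz] : cdom c z /\ W (cmap c z) by move: bz; rewrite domb.
apply/(bholonomicP Mc Md bz cz (bd z bz)).
rewrite bPE jacb // -bA_cmap // bAE // /A.
have [mc mb mcb mi] := bcdomP Mc (Wx _ Wz).
have [kc kb kcb ki] := bcdomP Md (Wy _ Wz).
have := (bholonomicP Mc Mc mb mc mcb).1 (hx _ mb).
rewrite -bA_cmap // bPE cinvK // => ->.
have := (bholonomicP Md Md kb kc kcb).1 (hy _ kb).
by rewrite -bA_cmap // bPE cinvK // => ->.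
Qed.

End Data.
End Construction.

(** * Jets commuting with the symmetry jet *)

HB.lock Definition symb (R : realType) (n : nat) (M : manifold R n)
  (s : M -> shjet M) (x : M) : bisection M := jrep (s x).

Section SymmetryJet.
Variables (R : realType) (n : nat) (M : manifold R n) (s : M -> shjet M).
Hypothesis hs : symmetry_jet s.
Implicit Types (c d e : chart R n M) (x y : M) (J : shjet M) (xi eta : B1 M).

Local Notation sb := (symb s).

Lemma sym_src x : jsrc (s x) = x. Proof. by case: hs. Qed.

Lemma sym_dom x : bdom (sb x) x.
Proof. by have := jrep_dom (s x); rewrite sym_src symb.unlock. Qed.

Lemma sym_val x : sb x x = B1neg x.
Proof. by case: hs => _ _ h; have := h x; rewrite /jp sym_src symb.unlock. Qed.

Lemma sym_base x : bbase (sb x) x = x.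
Proof. by rewrite /bbase sym_val. Qed.

Lemma sym_regular x : bregular x (sb x).
Proof. exact: bregular_bis (sym_dom x). Qed.

Lemma sym_bP c x : charts M c -> cdom c x -> bP c c (sb x) x = - 1%:M.
Proof.
move=> Mc cx; have := @sh_bP _ _ _ (s x) c c Mc Mc.
have -> : jtgt (s x) = x.
  by have e := sym_base x; rewrite symb.unlock in e; rewrite /jtgt sym_src.
rewrite sym_src symb.unlock => /(_ cx cx) ->.
by case: hs => _ _ ->; exact: bmat_neg.
Qed.

(* This is [- 2] times the Christoffel symbols of [nabla s] in the chart [c]. *)
Definition symD c x (v : 'rV[R]_n) : 'M[R]_n := bD c c (sb x) x v.

Lemma symD_linear c x : charts M c -> cdom c x -> linear (symD c x).
Proof.
move=> Mc cx; apply: (bD_linear Mc Mc (sym_regular x) cx).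
by rewrite sym_base.
Qed.

Lemma symDZ c x a v : charts M c -> cdom c x -> symD c x (a *: v) = a *: symD c x v.
Proof.
move=> Mc cx; apply: (bDZ Mc Mc (sym_regular x) cx).
by rewrite sym_base.
Qed.

(** The derivative that commutation with [s] forces on a jet over [xi]. *)
Definition affineD c d xi (v : 'rV[R]_n) : 'M[R]_n :=
  2^-1 *: (bmat c d xi *m symD d (btgt xi) (v *m bmat c d xi) -
           symD c (bsrc xi) v *m bmat c d xi).

(** The two products are compared through representatives, so that neither has to be packaged as a
    jet. *)
Definition sym_commutes J :=
  same_jet1 (jsrc J) (bisection_mul (jrep J) (sb (jsrc J)))
                     (bisection_mul (sb (jtgt J)) (jrep J)).

Section Commutes.
Variables (J : shjet M) (c d : chart R n M).
Hypotheses (Mc : charts M c) (Md : charts M d).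
Hypotheses (cx : cdom c (jsrc J)) (dy : cdom d (jtgt J)).
Let x := jsrc J.
Let y := jtgt J.
Let b := jrep J.

Lemma jet_sym_regular : bregular x (bisection_mul b (sb x)).
Proof.
apply: bregular_mul (sym_regular x) _; rewrite sym_base; exact: jrep_regular.
Qed.

Lemma sym_jet_regular : bregular x (bisection_mul (sb y) b).
Proof. exact: bregular_mul (jrep_regular J) (sym_regular y). Qed.

(** The value - id multiplies [bD] of [b], and the base derivative - id enters its argument; the two
    signs cancel. *)
Lemma jet_symE :
  bP c d (bisection_mul b (sb x)) x = - bmat c d (jp J) /\
  forall v, bD c d (bisection_mul b (sb x)) x v =
    symD c x v *m bmat c d (jp J) + bD c d b x v.
Proof.
have rb : bregular (bbase (sb x) x) b by rewrite sym_base; exact: jrep_regular.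
have cx' : cdom c (bbase (sb x) x) by rewrite sym_base.
have dy' : cdom d (bbase b (bbase (sb x) x)) by rewrite (sym_base x).
have bx := sym_base x; have val := sym_val x; have Px := sym_bP Mc cx.
split.
  have := bP_mul Mc Mc Md (sym_regular x) rb cx cx' dy'.
  by rewrite bx Px (sh_bP Mc Md cx dy) mulNmx mul1mx.
move=> v; have := bD_mul Mc Mc Md (sym_regular x) rb cx cx' dy' v.
rewrite bx Px val bmat_neg // mulmxN mulmx1 mulNmx mul1mx => ->.
have N : bD c d b x (- v) = - bD c d b x v.
  by rewrite -scaleN1r (bDZ Mc Md (jrep_regular J) cx dy) scaleN1r.
by rewrite N opprK.
Qed.

(** Here only the value - id meets the derivative of [b], whence the sign opposite to that in
    [jet_symE]. *)
Lemma sym_jetE :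
  bP c d (bisection_mul (sb y) b) x = - bmat c d (jp J) /\
  forall v, bD c d (bisection_mul (sb y) b) x v =
    bmat c d (jp J) *m symD d y (v *m bmat c d (jp J)) - bD c d b x v.
Proof.
have dy' : cdom d (bbase (sb y) y) by rewrite sym_base.
have rb := jrep_regular J.
split.
  rewrite (bP_mul Mc Md Md rb (sym_regular y) cx dy dy').
  by rewrite (sh_bP Mc Md cx dy) (sym_bP Md dy) mulmxN mulmx1.
move=> v; rewrite (bD_mul Mc Md Md rb (sym_regular y) cx dy dy').
rewrite (sh_bP Mc Md cx dy) sym_val (bmat_neg Md dy) mulmxN mulmx1.
by rewrite addrC.
Qed.

(* For [a = D b v], the two sides of the first equation are the derivatives of
   [b . s] and [s . b]. *)
Lemma half_eq (a e k : 'M[R]_n) : (k + a = e - a) <-> (a = 2^-1 *: (e - k)).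
Proof.
have half2 (w : 'M[R]_n) : 2^-1 *: (w + w) = w.
  by rewrite -mulr2n -(scaler_nat 2 w) scalerA mulVf // scale1r.
split=> [h|aE].
  have -> : e = k + (a + a) by rewrite addrA h subrK.
  by rewrite addrAC subrr add0r half2.
have -> : e = k + (a + a) by rewrite {1 2}aE -scalerDr half2 addrC subrK.
by rewrite addrA addrK.
Qed.

Lemma sym_commutes_affineD : sym_commutes J -> bD c d b x = affineD c d (jp J).
Proof.
move=> h; have dx : cdom d (bbase (bisection_mul b (sb x)) x).
  by have -> : bbase (bisection_mul b (sb x)) x = y
    by exact (congr1 (bbase (jrep J)) (sym_base (jsrc J))).
have [_ _ ED] := same_jet1_charts jet_sym_regular sym_jet_regular Mc Md cx dx h.
have [_ E1] := jet_symE; have [_ E2] := sym_jetE.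
apply/funext => v; apply/half_eq; rewrite jp_src.
by rewrite -E1 ED E2.
Qed.

End Commutes.

Lemma affineD_sym_commutes J :
  let c := chart_at (jsrc J) in let d := chart_at (jtgt J) in
  bD c d (jrep J) (jsrc J) = affineD c d (jp J) -> sym_commutes J.
Proof.
move=> c d E; have [Mc cx] := chart_atP (jsrc J); have [Md dy] := chart_atP (jtgt J).
have [P1 E1] := jet_symE Mc Md cx dy; have [P2 E2] := sym_jetE Mc Md cx dy.
have bE : bbase (bisection_mul (jrep J) (sb (jsrc J))) (jsrc J) = jtgt J.
  by exact (congr1 (bbase (jrep J)) (sym_base (jsrc J))).
apply/(same_jet1P (jet_sym_regular J) (sym_jet_regular J)); rewrite bE; split.
- rewrite /bisection_mul sym_base; apply: B1_eq => //=; rewrite ?sym_val //=.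
    by rewrite -/(jp J) jp_src.
  by rewrite mulNmx mul1mx mulmxN mulmx1.
- exact: etrans P1 (esym P2).
apply/funext => v; apply: etrans (E1 v) (etrans _ (esym (E2 v))).
apply/half_eq; rewrite E /affineD jp_src; reflexivity.
Qed.

(** Commutation fixes the derivative by [sym_commutes_affineD], and [shjet_ext] asks for nothing
    beyond this and [jp]. *)
Lemma affine_jet_unique J J' : jp J = jp J' -> sym_commutes J -> sym_commutes J' -> J = J'.
Proof.
move=> Ep h h'; apply: (shjet_ext Ep).
have Es : jsrc J = jsrc J' by rewrite -!jp_src Ep.
have Et : jtgt J = jtgt J' by rewrite -!jp_tgt Ep.
have [Mc cx] := chart_atP (jsrc J); have [Md dy] := chart_atP (jtgt J).
have cx' := cx; have dy' := dy; rewrite {2}Es in cx'; rewrite {2}Et in dy'.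
have E1 := sym_commutes_affineD Mc Md cx dy h.
have E2 := sym_commutes_affineD Mc Md cx' dy' h'; rewrite -Es -Ep in E2.
exact: etrans E1 (esym E2).
Qed.

(** Makes room for representatives of s(x) other than the one chosen by [jrep], in particular for
    holonomic ones. *)
Lemma sym_rep x (b : bisection M) : bdom b x -> same_jet1 x (sb x) b ->
  let c := chart_at x in
  [/\ b x = B1neg x, bP c c b x = - 1%:M & bD c c b x = symD c x].
Proof.
move=> bx h c; have [Mc cx] := chart_atP x.
have cx' : cdom c (bbase (sb x) x) by rewrite sym_base.
have [E EP ED] := same_jet1_charts (sym_regular x) (bregular_bis bx) Mc Mc cx cx' h.
split; first by rewrite -E sym_val.
  by rewrite -EP; exact: sym_bP.
exact: esym ED.
Qed.

Lemma sh_exists_rep xi (bx by_ : bisection M) :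
  bdom bx (bsrc xi) -> same_jet1 (bsrc xi) (sb (bsrc xi)) bx ->
  bdom by_ (btgt xi) -> same_jet1 (btgt xi) (sb (btgt xi)) by_ ->
  exists J : shjet M, [/\ jp J = xi, sym_commutes J &
    bholonomic bx -> bholonomic by_ -> holonomic_jet J].
Proof.
set x := bsrc xi; set y := btgt xi => dbx sx dby sy.
have [Ex Px Dx] := sym_rep dbx sx; have [Ey Py Dy] := sym_rep dby sy.
have [b [db bE bm bp [bd bh]]] :=
  symmetric_bisection (bmx_unit xi) dbx dby Ex Ey Px Py.
have [Mc cx] := chart_atP x; have [Md dy] := chart_atP y.
have bxi : b x = xi.
  apply: B1_eq; [exact: bis_src|exact: bE|].
  by rewrite -[LHS]bmat_chart_at (bis_src db) -[btgt (b x)]/(bbase b x) bE.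
have Jp := mkjet_jp db; rewrite bxi in Jp.
have Jt : jtgt (mkjet db) = y by rewrite -jp_tgt Jp.
have dbx' : cdom (chart_at y) (bbase b x) by rewrite bE.
have [JP JD] := mkjet_charts db Mc Md cx dbx'.
have sh : bmx (jp (mkjet db)) = jpstar (mkjet db).
  rewrite -sh_bP_chart_at Jp Jt.
  by apply: esym; apply: etrans JP bp.
exists (ShJet sh); split; first exact: Jp.
  have key : bD (chart_at x) (chart_at y) (jrep (mkjet db)) x =
             affineD (chart_at x) (chart_at y) xi.
    rewrite JD; apply/funext => v; rewrite bd /affineD bmat_chart_at.
    by rewrite Dx Dy.
  have key' : bD (chart_at x) (chart_at (jtgt (mkjet db))) (jrep (mkjet db)) x =
      affineD (chart_at x) (chart_at (jtgt (mkjet db))) (jp (mkjet db)).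
    by rewrite Jt Jp; exact: key.
  exact (@affineD_sym_commutes (ShJet sh) key').
move=> hx hy; exists (bbase b), b; split; first exact (jet1_class_refl db).
move=> z bz; split; first reflexivity.
exact (bh hx hy z bz).
Qed.

(** On the open domain of [b], the map [f] of [holonomic_jet] agrees with the base map, so their
    differentials agree there too. *)
Lemma holonomic_rep (J : jet M) : holonomic_jet J ->
  exists b : bisection M, [/\ bdom b (jsrc J), same_jet1 (jsrc J) (jrep J) b &
    bholonomic b].
Proof.
move=> [f [b [/jclsP[bx Jb] fb]]]; exists b; split=> // z bz.
have [ft ->] := fb z bz.
have [Mc cz] := chart_atP z; have [Md dz] := chart_atP (bbase b z).
rewrite /tmap -ft -[btgt (b z)]/(bbase b z).
have [_ /(_ _ Mc cz) [dphi _]] := (bregular_bis bz).2 _ Md dz.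
have E : bphi (chart_at z) (chart_at (bbase b z)) b =
  cmap (chart_at (bbase b z)) \o bbase b \o cinv (chart_at z).
  by rewrite bphi.unlock.
rewrite E in dphi.
have := near_jac _ dphi; rewrite jac.unlock => h; apply/esym/h.
have nb : \forall w \near z, bdom b w by apply: open_nbhs_nbhs; split => //; exact: bis_open.
apply: filterS (near_cinv Mc cz nb) => u bu /=.
by have [<- _] := fb _ bu.
Qed.

Lemma sh_exists xi : exists J : shjet M, [/\ jp J = xi, sym_commutes J &
  (holonomic_symmetry_jet s -> holonomic_jet J)].
Proof.
(* Holonomic representatives are at hand only when [s] is holonomic. Otherwise the chosen ones
   serve, and the last claim is vacuous. *)
have [hol|nhol] := pselect (holonomic_symmetry_jet s); last first.
  have sx x : same_jet1 x (sb x) (sb x) by split.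
  have [J [Jp JS _]] := sh_exists_rep (sym_dom (bsrc xi)) (sx (bsrc xi))
    (sym_dom (btgt xi)) (sx (btgt xi)).
  by exists J.
have [bx [dx sx hx]] := holonomic_rep (hol (bsrc xi)).
have [by_ [dy sy hy]] := holonomic_rep (hol (btgt xi)).
rewrite sym_src in dx sx; rewrite sym_src in dy sy.
have [J [Jp JS Jh]] := sh_exists_rep (xi := xi) (bx := bx) (by_ := by_)
  dx ltac:(rewrite symb.unlock; exact: sx) dy ltac:(rewrite symb.unlock; exact: sy).
by exists J; split => // _; exact: Jh.
Qed.

Definition symS xi : shjet M := projT1 (cid (sh_exists xi)).

Lemma symS_jp xi : jp (symS xi) = xi.
Proof. by case: (projT2 (cid (sh_exists xi))). Qed.

Lemma symS_commutes xi : sym_commutes (symS xi).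
Proof. by case: (projT2 (cid (sh_exists xi))). Qed.

Lemma symS_holonomic xi : holonomic_symmetry_jet s -> holonomic_jet (symS xi).
Proof. by case: (projT2 (cid (sh_exists xi))). Qed.

Lemma symS_unique J : sym_commutes J -> J = symS (jp J).
Proof.
move=> h; apply: affine_jet_unique h (symS_commutes _).
by rewrite symS_jp.
Qed.

End SymmetryJet.

(** A form of [bD_mul] whose intermediate point and values are variables tied by equations, so that
    it applies without rewriting inside dependent terms. *)
Lemma bD_mul_at (R : realType) (n : nat) (M : manifold R n) (c d e : chart R n M)
    (x y : M) (xi eta : B1 M) (b b' : M -> B1 M) :
  charts M c -> charts M d -> charts M e -> bregular x b -> bregular y b' ->
  b x = xi -> bbase b x = y -> b' y = eta ->
  cdom c x -> cdom d y -> cdom e (btgt eta) -> forall v,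
  bD c e (bisection_mul b' b) x v =
  bD c d b x v *m bmat d e eta + bmat c d xi *m bD d e b' y (v *m bP c d b x).
Proof.
move=> Mc Md Me rb rb' <- yE <- cx dy ez v; move: rb' dy ez; rewrite -yE.
by move=> rb' dy ez; exact: bD_mul.
Qed.

(** * Multiplicativity of the morphism and uniqueness *)

Section Morphism.
Variables (R : realType) (n : nat) (M : manifold R n) (s : M -> shjet M).
Hypothesis hs : symmetry_jet s.
Implicit Types (c d e : chart R n M) (x y : M) (J : shjet M) (xi eta : B1 M).
(** [S] enters only through the two properties below, which [symS] has by construction. *)
Variable S : B1 M -> shjet M.
Hypothesis S_jp : forall xi, jp (S xi) = xi.
Hypothesis S_commutes : forall xi, sym_commutes s (S xi).
Local Notation sb := (symb s).

Lemma S_src xi : jsrc (S xi) = bsrc xi.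
Proof. by rewrite -jp_src S_jp. Qed.

Lemma S_tgt xi : jtgt (S xi) = btgt xi.
Proof. by rewrite -jp_tgt S_jp. Qed.

Lemma S_regular xi : bregular (bsrc xi) (jrep (S xi)).
Proof. by rewrite -S_src; exact: jrep_regular. Qed.

Lemma S_val xi : jrep (S xi) (bsrc xi) = xi.
Proof. by rewrite -S_src; exact: S_jp. Qed.

Lemma S_base xi : bbase (jrep (S xi)) (bsrc xi) = btgt xi.
Proof. by rewrite /bbase S_val. Qed.

Lemma S_D xi c d : charts M c -> charts M d -> cdom c (bsrc xi) -> cdom d (btgt xi) ->
  bD c d (jrep (S xi)) (bsrc xi) = affineD s c d xi.
Proof.
rewrite -S_src -S_tgt => Mc Md cx dy.
have := sym_commutes_affineD hs Mc Md cx dy (S_commutes xi).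
by rewrite S_jp.
Qed.

Lemma S_P xi c d : charts M c -> charts M d -> cdom c (bsrc xi) -> cdom d (btgt xi) ->
  bP c d (jrep (S xi)) (bsrc xi) = bmat c d xi.
Proof.
rewrite -S_src -S_tgt => Mc Md cx dy.
by have := sh_bP Mc Md cx dy; rewrite S_jp.
Qed.

Lemma bmat_mul c d e eta xi : bsrc eta = btgt xi -> charts M d -> cdom d (btgt xi) ->
  bmat c e (B1mul eta xi) = bmat c d xi *m bmat d e eta.
Proof.
move=> E Md dy; rewrite bmat.unlock /= E !mulmxA mulmxK //.
by have := tc_unit Md dy.
Qed.

(** The two terms with the symbol of [s] at the intermediate point occur with opposite signs and
    cancel. *)
Lemma affineD_mul c d e eta xi v : bsrc eta = btgt xi ->
  charts M d -> cdom d (btgt xi) ->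
  affineD s c d xi v *m bmat d e eta + bmat c d xi *m affineD s d e eta (v *m bmat c d xi) =
  affineD s c e (B1mul eta xi) v.
Proof.
move=> E Md dy; rewrite /affineD (bmat_mul c e E Md dy) E /=.
rewrite -scalemxAl -scalemxAr -scalerDr; congr (_ *: _).
by rewrite mulmxBl mulmxBr !mulmxA addrC subrKA.
Qed.

Lemma S_mul eta xi : bsrc eta = btgt xi -> jet_mul (S eta) (S xi) (S (B1mul eta xi)).
Proof.
move=> E; split.
- exact: etrans (S_src eta) (etrans E (esym (S_tgt xi))).
- exact (etrans (S_src (B1mul eta xi)) (esym (S_src xi))).
rewrite (S_src xi).
have [Mc cx] := chart_atP (bsrc xi); have [Md dy] := chart_atP (btgt xi).
have [Me ez] := chart_atP (btgt eta).
have rxi := S_regular xi.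
have reta : bregular (bbase (jrep (S xi)) (bsrc xi)) (jrep (S eta)).
  by rewrite S_base -E; exact: S_regular.
have dy' : cdom (chart_at (btgt xi)) (bbase (jrep (S xi)) (bsrc xi)) by rewrite S_base.
have y1 := etrans (S_base xi) (esym E).
have z1 := etrans (congr1 (bbase (jrep (S eta))) y1) (S_base eta).
have ez' : cdom (chart_at (btgt eta)) (bbase (jrep (S eta)) (bbase (jrep (S xi)) (bsrc xi))).
  by rewrite z1.
have bE : bbase (bisection_mul (jrep (S eta)) (jrep (S xi))) (bsrc xi) = btgt eta.
  exact z1.
have dsrc : cdom (chart_at (btgt xi)) (bsrc eta) by rewrite E.
have V : jrep (S eta) (bbase (jrep (S xi)) (bsrc xi)) = eta.
  exact (etrans (congr1 (jrep (S eta)) y1) (S_val eta)).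
have P1 := bP_mul Mc Md Me rxi reta cx dy' ez'.
have D1 := bD_mul_at Mc Md Me rxi (S_regular eta) (S_val xi) y1 (S_val eta) cx dsrc ez.
rewrite (S_P Mc Md cx dy) y1 (S_P Md Me dsrc ez) in P1.
apply/(same_jet1P (bregular_mul rxi reta) (S_regular (B1mul eta xi))).
rewrite bE; split.
- exact (etrans (f_equal2 (@B1mul R n M) V (S_val xi)) (esym (S_val (B1mul eta xi)))).
- apply: etrans P1 _; apply: esym; apply: etrans (S_P (xi := B1mul eta xi) Mc Me cx ez) _.
  exact: bmat_mul.
- apply/funext => v; apply: etrans (D1 v) _.
  have e1 := congr1 (fun f => f v) (S_D Mc Md cx dy).
  have e2 := etrans (congr1 (fun f => f (v *m bP _ _ (jrep (S xi)) (bsrc xi)))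
    (S_D Md Me dsrc ez))
    (congr1 (fun P => affineD s (chart_at (btgt xi)) (chart_at (btgt eta)) eta (v *m P))
      (S_P Mc Md cx dy)).
  apply: etrans (f_equal2 (fun p q => p *m bmat _ _ eta + bmat _ _ xi *m q) e1 e2) _.
  apply: etrans (affineD_mul _ _ _ E Md dy) _.
  exact (congr1 (fun f => f v) (esym (S_D (xi := B1mul eta xi) Mc Me cx ez))).
Qed.

Lemma sym_commutes_s x : sym_commutes s (s x).
Proof.
rewrite /sym_commutes; have xs := sym_src hs x.
have xt : jtgt (s x) = x by rewrite -jp_tgt; case: hs => _ _ ->.
by rewrite xs xt symb.unlock; split.
Qed.

(** s(x) commutes with itself and lies over - I, so it is the jet singled out by
    [affine_jet_unique]. *)
Lemma S_neg x : S (B1neg x) = s x.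
Proof.
apply: (affine_jet_unique hs _ (S_commutes _) (sym_commutes_s x)).
by rewrite S_jp; case: hs.
Qed.

Lemma morphism_commutes (S' : B1 M -> shjet M) :
  (forall eta xi, bsrc eta = btgt xi -> jet_mul (S' eta) (S' xi) (S' (B1mul eta xi))) ->
  (forall x, S' (B1neg x) = s x) -> (forall xi, jp (S' xi) = xi) ->
  forall xi, sym_commutes s (S' xi).
Proof.
move=> mulS' S'neg S'jp xi.
have src : jsrc (S' xi) = bsrc xi by rewrite -jp_src S'jp.
have tgt : jtgt (S' xi) = btgt xi by rewrite -jp_tgt S'jp.
have [_ _ h1] := mulS' xi (B1neg (bsrc xi)) erefl.
have [_ _ h2] := mulS' (B1neg (btgt xi)) xi erefl.
have E : B1mul (B1neg (btgt xi)) xi = B1mul xi (B1neg (bsrc xi)).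
  by apply: B1_eq => //=; rewrite mulmxN mulmx1 mulNmx mul1mx.
rewrite E S'neg src in h2; rewrite S'neg (sym_src hs) in h1.
have r1 := jet_sym_regular hs (S' xi); have r2 := sym_jet_regular hs (S' xi).
have r3 : bregular (bsrc xi) (jrep (S' (B1mul xi (B1neg (bsrc xi))))).
  have e : jsrc (S' (B1mul xi (B1neg (bsrc xi)))) = bsrc xi by rewrite -jp_src S'jp.
  by have := jrep_regular (S' (B1mul xi (B1neg (bsrc xi)))); rewrite e.
rewrite /sym_commutes; move: r1 r2; rewrite src tgt symb.unlock => r1 r2.
(* Both products have the jet of S'(xi . (- I)), which is S'((- I) . xi), as common middle term. *)
exact: same_jet1_trans r1 r3 r2 h1 (same_jet1_sym r2 r3 h2).
Qed.

End Morphism.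

(** * Smoothness of the morphism *)

Section Smoothness.
Variables (R : realType) (n : nat) (M : manifold R n) (s : M -> shjet M).
Hypothesis hs : symmetry_jet s.
Implicit Types (c d e : chart R n M) (x y : M) (J : shjet M) (xi eta : B1 M).
Variable S : B1 M -> shjet M.
Hypothesis S_jp : forall xi, jp (S xi) = xi.
Hypothesis S_commutes : forall xi, sym_commutes s (S xi).
Local Notation sb := (symb s).

(** The encoding of a linear map that [shjet_coord] uses for the derivative part. *)
Definition rows_mx (L : 'rV[R]_n -> 'M[R]_n) : 'M[R]_(n, n * n) :=
  \matrix_(i < n) mxvec (L (delta_mx 0 i)).

Lemma rows_mxK (L : 'rV[R]_n -> 'M[R]_n) v : linear L -> vec_mx (v *m rows_mx L) = L v.
Proof.
move=> lL; pose LM := GRing.isLinear.Build _ _ _ _ _ lL.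
pose LL : {linear 'rV[R]_n -> 'M[R]_n} := HB.pack L LM.
have -> : L v = \sum_i v 0 i *: L (delta_mx 0 i).
  rewrite -[L]/(LL : _ -> _) {1}(row_sum_delta v) linear_sum.
  by apply: eq_bigr => i _; rewrite linearZ.
rewrite mulmx_sum_row linear_sum; apply: eq_bigr => i _.
by rewrite linearZ /= rowK mxvecK.
Qed.

Lemma shjet_coordE J c d : charts M c -> charts M d -> cdom c (jsrc J) -> cdom d (jtgt J) ->
  shjet_coord c d J = (B1coord c d (jp J), rows_mx (bD c d (jrep J) (jsrc J))).
Proof.
move=> Mc Md cx dy; rewrite /shjet_coord; congr (_, _).
have h := bA_is_diff Mc Md (jrep_regular J) cx dy.
have lmx : linear (mxvec : 'M[R]_n -> 'rV[R]_(n * n)) by exact: linearP.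
have := is_diff_comp h (linear_is_diff (bA c d (jrep J) (cmap c (jsrc J))) lmx
  (mx_linear_continuous lmx)).
have -> : mxvec \o bA c d (jrep J) =
    (fun u => mxvec (B1coord c d (jrep J (cinv c u))).2).
  by apply/funext => u; rewrite B1coordE bA.unlock.
move=> g; have [dg _] := g.
apply/row_matrixP => i; rewrite rowK rowE.
apply: etrans (esym (deriveEjacobian _ dg)) _.
by rewrite (is_diff_derive _ g).
Qed.

(** [c] parametrizes the base point while derivatives are read in [d]: smoothness of [S] is tested
    with one chart on B^(1) and possibly another on the jets. *)
Definition symQ c d (u : 'rV[R]_n) : 'M[R]_(n, n * n) :=
  (shjet_coord d d (s (cinv c u))).2.

Lemma smooth_symQ c d : charts M c -> charts M d ->
  smooth_on (cmap c @` (cdom c `&` cdom d)) (symQ c d).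
Proof.
move=> Mc Md; have oB := open_chart_image Mc (m_dom_open Md).
apply: smooth_on_snd => //.
have [ssm ssrc sjp] := hs.
have stgt x : jtgt (s x) = x by rewrite -jp_tgt sjp.
apply: (@smooth_at_smooth_on _ _ _ _ _ (shjet_atlas M) s c
  ([set J : shjet M | cdom d (jsrc J) /\ cdom d (jtgt J)], shjet_coord d d)) => //.
  by exists d, d.
by move=> x dx /=; rewrite stgt ssrc.
Qed.

Lemma symQE c d x v : charts M c -> charts M d -> cdom c x -> cdom d x ->
  symD s d x v = vec_mx (v *m symQ c d (cmap c x)).
Proof.
move=> Mc Md cx dx; have [ssm ssrc sjp] := hs.
have stgt z : jtgt (s z) = z by rewrite -jp_tgt sjp.
rewrite /symQ m_cmapK // shjet_coordE ?ssrc ?stgt //=.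
have := symD_linear hs Md dx; rewrite /symD symb.unlock => lD.
by rewrite rows_mxK.
Qed.

(** [affineD] with the symbols of [s] entered as matrices, hence polynomial in its arguments. The
    difference is written with a scalar -1 to fit the closure lemmas for sums and multiples. *)
Definition affineQ (B : 'M[R]_n) (Qx Qy : 'M[R]_(n, n * n)) : 'M[R]_(n, n * n) :=
  rows_mx (fun v => 2^-1 *: (B *m vec_mx (v *m B *m Qy) + (-1) *: (vec_mx (v *m Qx) *m B))).

Lemma affineQE c d c' d' xi : charts M c -> charts M d -> charts M c' -> charts M d' ->
  cdom c (bsrc xi) -> cdom d (btgt xi) -> cdom c' (bsrc xi) -> cdom d' (btgt xi) ->
  rows_mx (affineD s c' d' xi) = affineQ (bmat c' d' xi)
    (symQ c c' (cmap c (bsrc xi))) (symQ d d' (cmap d (btgt xi))).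
Proof.
move=> Mc Md Mc' Md' cx dy c'x d'y; rewrite /affineQ; congr rows_mx.
apply/funext => v; rewrite /affineD scaleN1r.
by rewrite (symQE _ Mc Mc' cx c'x) (symQE _ Md Md' dy d'y).
Qed.

Lemma S_smooth : smooth_map (B1atlas M) (shjet_atlas M) S.
Proof.
move=> xi _ _ [c [d [Mc Md ->]]] [c' [d' [Mc' Md' ->]]] /= [cx dy].
rewrite (S_src S_jp) (S_tgt S_jp) => -[c'x d'y].
pose W := B1trans_dom c d c' d'.
have oc := open_chart_image Mc (m_dom_open Mc').
have od := open_chart_image Md (m_dom_open Md').
have oW : open W by exact: open_B1dom.
(* The coordinate expression of [S]: a mere change of charts on the part in B^(1), since p . S is
   the identity, and [affineQ] on the derivatives. *)
pose F (p : 'rV[R]_n * 'rV[R]_n * 'M[R]_n) := (B1trans c d c' d' p,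
   affineQ (B1trans c d c' d' p).2 (symQ c c' p.1.1) (symQ d d' p.1.2)).
have sT : smooth_on W (B1trans c d c' d') by exact: smooth_B1trans.
have sB : smooth_on W (fun p => (B1trans c d c' d' p).2) by exact: smooth_on_snd.
have sid : smooth_on W id by exact: smooth_on_id.
have s11 : smooth_on W (fun p => p.1.1).
  exact: (smooth_on_fst oW (smooth_on_fst oW sid)).
have s12 : smooth_on W (fun p => p.1.2).
  exact: (smooth_on_snd oW (smooth_on_fst oW sid)).
have sQ1 : smooth_on W (fun p => symQ c c' p.1.1).
  apply: (smooth_on_comp oW _ s11 (smooth_symQ Mc Mc')).
  by move=> p [].
have sQ2 : smooth_on W (fun p => symQ d d' p.1.2).
  apply: (smooth_on_comp oW _ s12 (smooth_symQ Md Md')).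
  by move=> p [].
have svec v (G : _ -> 'M[R]_(n, n * n)) : smooth_on W G ->
    smooth_on W (fun p => vec_mx (v *m G p) : 'M[R]_n).
  move=> sG; apply: (smooth_on_mxlin oW) => //; first exact: linearP.
  by apply: smooth_on_mulmx => //; exact: smooth_on_cst.
have svec' (B : _ -> 'M[R]_n) v (G : _ -> 'M[R]_(n, n * n)) : smooth_on W B -> smooth_on W G ->
    smooth_on W (fun p => vec_mx (v *m B p *m G p) : 'M[R]_n).
  move=> sB' sG; apply: (smooth_on_mxlin oW) => //; first exact: linearP.
  apply: smooth_on_mulmx => //; apply: smooth_on_mulmx => //; exact: smooth_on_cst.
have sF : smooth_on W F.
  apply: smooth_on_pair => //; apply: smooth_on_mx => // i j.
  pose G p := mxvec (2^-1 *: ((B1trans c d c' d' p).2 *m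
     vec_mx (delta_mx 0 i *m (B1trans c d c' d' p).2 *m symQ d d' p.1.2) + (-1) *:
     (vec_mx (delta_mx 0 i *m symQ c c' p.1.1) *m (B1trans c d c' d' p).2))).
  have -> : (fun p => affineQ (B1trans c d c' d' p).2 (symQ c c' p.1.1)
                        (symQ d d' p.1.2) i j) =
            (fun p => G p 0 j).
    by apply/funext => p; rewrite /affineQ /rows_mx mxE.
  apply: smooth_on_coord => //; apply: smooth_on_mxlin => //; first exact: linearP.
  apply: smooth_on_scale => //; apply: smooth_on_add => //.
    by apply: smooth_on_mulmx => //; exact: svec'.
  exact: (smooth_on_scale _ oW (smooth_on_mulmx oW (svec _ _ sQ1) sB)).
exists W, F; split => //.
  by split; [exists (bsrc xi)|exists (btgt xi)].
move=> eta [cx0 dy0] [[x [cx1 c'x1] xE] [y [dy1 d'y1] yE]].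
rewrite B1coordE /= in xE yE.
(* Membership in [W] only says that the coordinates of [eta] come from some points of the overlaps;
   injectivity of the charts identifies these with its end points. *)
have xE' : x = bsrc eta by rewrite -(m_cmapK Mc cx1) xE m_cmapK.
have yE' : y = btgt eta by rewrite -(m_cmapK Md dy1) yE m_cmapK.
rewrite xE' in c'x1; rewrite yE' in d'y1.
have sS := S_src S_jp eta; have tS := S_tgt S_jp eta.
split; first by rewrite sS tS.
have cS : cdom c' (jsrc (S eta)) by rewrite sS.
have dS : cdom d' (jtgt (S eta)) by rewrite tS.
rewrite (shjet_coordE Mc' Md' cS dS) S_jp sS (S_D hs S_jp S_commutes Mc' Md' c'x1 d'y1).
rewrite (affineQE Mc Md Mc' Md' cx0 dy0 c'x1 d'y1).
rewrite /F -(B1coord_trans Mc Md Mc' Md' cx0 dy0 c'x1 d'y1).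
by rewrite !B1coordE.
Qed.

End Smoothness.

(** * The connection and its affine jets *)

Section Pushforward.
Variables (R : realType) (n : nat) (M : manifold R n).
Implicit Types (c d : chart R n M) (x y : M) (b : bisection M) (X Y : vfield M).

Lemma vrepE c X u : vrep c X u = X (cinv c u) *m tc c (cinv c u).
Proof. by rewrite tc.unlock. Qed.

Lemma pushE b Y x : bdom b x -> push b Y (bbase b x) = Y x *m bmx (b x).
Proof.
move=> bx; rewrite /push; case: pselect => [h|]; last by case; exists x.
(* The preimage picked by [push] is [x] because the base map has a left inverse on the domain. *)
have [bz zx] := projT2 (cid h); have [g [gK _]] := bis_diffeo b.
by rewrite -(gK _ bz) zx gK.
Qed.

Section Derivative.
Variables (c d : chart R n M) (b : bisection M) (x : M) (Y : vfield M).
Hypotheses (Mc : charts M c) (Md : charts M d) (bx : bdom b x).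
Hypotheses (cx : cdom c x) (dy : cdom d (bbase b x)).
Hypothesis dY : differentiable (vrep c Y) (cmap c x).

Lemma vrep_push u : bcdom c d b u ->
  vrep d (push b Y) (bphi c d b u) = vrep c Y u *m bA c d b u.
Proof.
move=> /(bcdomP Mc) [cu bu du _].
rewrite !vrepE bphi.unlock (m_cmapK Md du) pushE // bA.unlock bmat.unlock.
by rewrite (bis_src bu) !mulmxA mulmxK //; exact: tc_unit.
Qed.

Let Dx : bcdom c d b (cmap c x).
Proof. by exists x. Qed.

(** By [vrep_push], in charts the pushed field is the product of [Y] with the matrix part, composed
    with the inverse of the base map. *)
Lemma push_differentiable : differentiable (vrep d (push b Y)) (cmap d (bbase b x)).
Proof.
have [g lg] := @bphi_local_diffeo _ _ _ c d b Mc Md.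
have [oW sf ofW sg gK] := lg.
have Ex : bphi c d b (cmap c x) = cmap d (bbase b x) by exact: bphi_cmap.
have imx : (bphi c d b @` bcdom c d b) (cmap d (bbase b x)) by exists (cmap c x).
have gx : g (cmap d (bbase b x)) = cmap c x by rewrite -Ex gK.
have dg : differentiable g (cmap d (bbase b x)) by exact: smooth_on_differentiable sg imx.
have h1 : is_diff (g (cmap d (bbase b x))) (vrep c Y) ('d (vrep c Y) (cmap c x)).
  by rewrite gx; exact: differentiableP.
have h2 : is_diff (g (cmap d (bbase b x))) (bA c d b) (bD c d b x).
  by rewrite gx; exact: bA_is_diff Mc Md (bregular_bis bx) cx dy.
have k1 := is_diff_comp (differentiableP dg) h1.
have k2 := is_diff_comp (differentiableP dg) h2.
have [k3 _] := mulmx_is_diff k1 k2.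
apply: near_differentiable k3.
have : \forall w \near cmap d (bbase b x), (bphi c d b @` bcdom c d b) w.
  exact: open_nbhs_nbhs.
by apply: filterS => _ [u Du <-] /=; rewrite gK // vrep_push.
Qed.

(** The identity [vrep_push] is differentiated along [v]: chain rule on the left, product rule on
    the right. *)
Lemma push_derive v :
  'D_(v *m bP c d b x) (vrep d (push b Y)) (cmap d (bbase b x)) =
  'D_v (vrep c Y) (cmap c x) *m bmat c d (b x) + vrep c Y (cmap c x) *m bD c d b x v.
Proof.
have hA := bA_is_diff Mc Md (bregular_bis bx) cx dy.
have hphi := bphi_is_diff Mc Md (bregular_bis bx) cx dy.
have hp := differentiableP push_differentiable; rewrite -(bphi_cmap d b Mc cx) in hp.
have k := is_diff_comp hphi hp.
have m := mulmx_is_diff (differentiableP dY) hA.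
have E : \forall u \near cmap c x, vrep c Y u *m bA c d b u =
    (vrep d (push b Y) \o bphi c d b) u.
  have oD : open (bcdom c d b) by exact: open_bcdom.
  have : \forall u \near cmap c x, bcdom c d b u by exact: open_nbhs_nbhs.
  by apply: filterS => u Du /=; rewrite vrep_push.
have F := etrans (esym (is_diff_derive v k))
  (etrans (esym (near_eq_derive v E)) (is_diff_derive v m)).
rewrite /= (bphi_cmap d b Mc cx) (bA_cmap d b Mc cx) in F.
apply: etrans (deriveE _ push_differentiable) (etrans F _).
exact (congr1 (fun z => z *m _ + _) (esym (deriveE v dY))).
Qed.

End Derivative.
End Pushforward.

Section Connection.
Variables (R : realType) (n : nat) (M : manifold R n) (s : M -> shjet M).
Hypothesis hs : symmetry_jet s.
Implicit Types (c d : chart R n M) (x y : M) (X Y : vfield M).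
Local Notation sb := (symb s).

Lemma vrep_extend x v u : cimg (chart_at x) u -> vrep (chart_at x) (extend x v) u = v.
Proof.
have [Mc cx] := chart_atP x => cu.
have -> : extend x v = (fun z => v *m invmx (tc (chart_at x) z)) by rewrite tc.unlock.
by rewrite vrepE mulmxKV //; apply: tc_unit => //; exact: cinv_dom.
Qed.

Lemma near_vrep_extend x v :
  \forall u \near cmap (chart_at x) x, vrep (chart_at x) (extend x v) u = v.
Proof.
have [Mc cx] := chart_atP x.
by apply: filterS (near_cimg Mc cx) => u; exact: vrep_extend.
Qed.

Lemma vrep_at x Y : vrep (chart_at x) Y (cmap (chart_at x) x) = Y x.
Proof.
by have [Mc cx] := chart_atP x; rewrite vrepE m_cmapK // tc_chart_at mulmx1.
Qed.

Lemma nablaE x v Y : let c := chart_at x in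
  differentiable (vrep c Y) (cmap c x) ->
  nabla s (extend x v) Y x =
  'D_v (vrep c Y) (cmap c x) - 2^-1 *: (Y x *m symD s c x v).
Proof.
move=> c dY; have [Mc cx] := chart_atP x.
have cx' : cdom c (bbase (sb x) x) by rewrite (sym_base hs).
have dP := push_differentiable Mc Mc (sym_dom hs x) cx cx' dY.
(* The base derivative of s(x) is - id, so [- v] is the direction for which the pushed field is
   differentiated along [v]. *)
have DP := push_derive Mc Mc (sym_dom hs x) cx cx' dY (- v).
rewrite (sym_base hs) in dP DP.
rewrite (sym_bP hs Mc cx) (sym_val hs) (bmat_neg Mc cx) mulmxN mulmx1 opprK in DP.
have symN : bD c c (sb x) x (- v) = - symD s c x v.
  by rewrite -scaleN1r -[LHS]/(symD s c x _) (symDZ hs) // scaleN1r.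
have DN : 'D_(- v) (vrep c Y) (cmap c x) = - 'D_v (vrep c Y) (cmap c x).
  by rewrite !(deriveE _ dY) linearN.
rewrite symN mulmxN mulmx1 mulmxN DN opprK vrep_at in DP.
rewrite /nabla /bracket -/c.
have -> : vrep c (extend x v) (cmap c x) = v by exact: nbhs_singleton (near_vrep_extend x v).
(* [extend x v] has constant components in this chart, so the second term of the bracket
   vanishes. *)
rewrite (near_eq_derive _ (near_vrep_extend x v)) derive_cst subr0.
have -> : vrep c (fun z => Y z + push (jrep (s x)) Y z) =
    vrep c Y + vrep c (push (sb x) Y).
  by apply/funext => u; rewrite !fctE !vrepE mulmxDl symb.unlock.
rewrite deriveD; [|exact: diff_derivable|exact: diff_derivable].
rewrite DP addrA -mulr2n scalerBr -(scaler_nat 2 ('D_v _ _)) scalerA mulVf //.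
by rewrite scale1r.
Qed.

(** Because p = p_*, the derivative of [Y] contributes the same term to both sides of the affine
    condition. After cancellation only the value of [Y] at the source is left. *)
Lemma affine_jetP (J : shjet M) :
  affine_jet (nabla s) J <-> forall v Y, smooth_vfield Y ->
    Y (jsrc J) *m bD (chart_at (jsrc J)) (chart_at (jtgt J)) (jrep J) (jsrc J) v =
    Y (jsrc J) *m affineD s (chart_at (jsrc J)) (chart_at (jtgt J)) (jp J) v.
Proof.
have [Mc cx] := chart_atP (jsrc J); have [Md dy] := chart_atP (jtgt J).
have key v Y : smooth_vfield Y ->
  nabla s (extend (jsrc J) v) Y (jsrc J) *m bmx (jrep J (jsrc J)) =
  nabla s (extend (jtgt J) (v *m bmx (jrep J (jsrc J)))) (push (jrep J) Y) (jtgt J) <->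
  Y (jsrc J) *m bD (chart_at (jsrc J)) (chart_at (jtgt J)) (jrep J) (jsrc J) v =
  Y (jsrc J) *m affineD s (chart_at (jsrc J)) (chart_at (jtgt J)) (jp J) v.
  move=> sY.
  have dY : differentiable (vrep (chart_at (jsrc J)) Y) (cmap (chart_at (jsrc J)) (jsrc J)).
    by apply: smooth_on_differentiable (sY _ Mc) _; exists (jsrc J).
  have dP := push_differentiable Mc Md (jrep_dom J) cx dy dY.
  have DP := push_derive Mc Md (jrep_dom J) cx dy dY v.
  have BE : bmat (chart_at (jsrc J)) (chart_at (jtgt J)) (jp J) = bmx (jp J).
    by have := bmat_chart_at (jp J); rewrite jp_src.
  rewrite (sh_bP Mc Md cx dy) -/(jp J) BE vrep_at in DP.
  rewrite -/(jp J).
  have E1 := nablaE v dY.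
  have E2 := nablaE (x := jtgt J) (v *m bmx (jp J)) dP.
  have E3 : push (jrep J) Y (jtgt J) = Y (jsrc J) *m bmx (jp J) by exact: pushE (jrep_dom J).
  have E4 := etrans E2 (f_equal2 (fun p q => p - 2^-1 *: (q *m
    symD s (chart_at (jtgt J)) (jtgt J) (v *m bmx (jp J)))) DP E3).
  rewrite /affineD BE jp_src jp_tgt.
  have iff2 (T : Type) (a a' b b' : T) : a = a' -> b = b' -> (a = b) <-> (a' = b').
    by move=> -> ->.
  have E5 := congr1 (fun z => z *m bmx (jp J)) E1.
  refine (iff_trans (iff2 _ _ _ _ _ E5 E4) _).
  clear iff2 E1 E2 E3 E4 E5 DP.
  move: ('D_v _ _) => D; move: (symD _ _ _ _) => K1.
  move: (symD _ _ _ _) => K2.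
  move: (bD _ _ _ _ _) (bmx _) (Y _) => L B Yx.
  rewrite mulmxBl -addrA -scalemxAr mulmxBr scalerBr -scalemxAl !mulmxA.
  split=> [/addrI h|->].
    by rewrite addrC h subrK.
  by rewrite addrAC subrr add0r.
split=> [H v Y sY|H x y b v Y sY]; first exact ((key v Y sY).1 (H v Y sY)).
exact ((key v Y sY).2 (H v Y sY)).
Qed.

End Connection.

(** * Bump vector fields *)

Section Flat.
Variable R : realType.
Implicit Types (p : {poly R}) (t : R).

(* The derivative of [p (1/t) exp (- 1/t)] is [q (1/t) exp (- 1/t)] with
   [q = X^2 (p - p')], so these functions are smooth at once for all [p]. *)
Definition flat p t : R := if 0 < t then p.[t^-1] * expR (- t^-1) else 0.

(** One term of the exponential series gives e^(1/t) >= (1/t)^(i+2) / (i+2)!. This absorbs the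
    factor (1/t)^i and leaves t^2. *)
Lemma flat_Xn_le i t : t <= 1 -> `|flat 'X^i t| <= (i.+2)`!%:R * t ^+ 2.
Proof.
move=> t1; rewrite /flat; case: ifPn => t0; last first.
  by rewrite normr0 mulr_ge0 // sqr_ge0.
rewrite hornerXn normrM !ger0_norm ?expR_ge0 ?exprn_ge0 ?invr_ge0 ?(ltW t0) //.
rewrite expRN ler_pdivrMr ?expR_gt0 //.
have := @expR_ge1Dxn R t^-1 i.+1; rewrite invr_ge0 (ltW t0) => /(_ isT) h.
have {}h : t^-1 ^+ i.+2 / (i.+2)`!%:R <= expR t^-1.
  by apply: le_trans h; rewrite lerDr ler01.
have f0 : 0 < (i.+2)`!%:R * t ^+ 2 by rewrite mulr_gt0 ?exprn_gt0 // ltr0n fact_gt0.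
apply: le_trans (ler_wpM2l (ltW f0) h).
rewrite le_eqVlt; apply/orP; left; apply/eqP.
have ft : (i.+2)`!%:R != 0 :> R by rewrite pnatr_eq0 -lt0n fact_gt0.
have tn0 : t != 0 by rewrite gt_eqF.
have -> : t^-1 ^+ i.+2 = t^-1 ^+ i * t^-1 ^+ 2 by rewrite -exprD addn2.
move: ((i.+2)`!%:R : R) (t^-1 ^+ i) ft => a b a0.
by field; rewrite a0 tn0.
Qed.

Lemma flat_le p : exists C, forall t, t <= 1 -> `|flat p t| <= C * t ^+ 2.
Proof.
exists (\sum_(i < size p) `|p`_i| * (i.+2)`!%:R) => t t1.
have -> : flat p t = \sum_(i < size p) p`_i * flat 'X^i t.
  rewrite /flat; case: ifP => _; last by rewrite big1 // => i _; rewrite mulr0.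
  by rewrite horner_coef mulr_suml; apply: eq_bigr => i _; rewrite hornerXn mulrA.
apply: le_trans (ler_norm_sum _ _ _) _; rewrite mulr_suml; apply: ler_sum => i _.
by rewrite normrM -mulrA ler_wpM2l // flat_Xn_le.
Qed.

(** Serves at the gluing point 0 of [flat], where neither of the two formulas holds on a full
    neighbourhood. *)
Lemma square_bound_is_diff (f : R -> R) C :
  (forall t, t <= 1 -> `|f t| <= C * t ^+ 2) -> is_diff (0 : R) f (fun=> 0).
Proof.
move=> fC; have f0 : f 0 = 0.
  by apply/eqP; rewrite -normr_le0 (le_trans (fC _ ler01)) // expr0n mulr0.
have c0 : continuous (\0 : R -> R) by move=> y; exact: cst_continuous.
have E : f \o shift 0 = cst (f 0) + (\0 : R -> R) +o_ (0 : R) id.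
  apply/eqaddoP => e e0.
  have C0 : 0 < `|C| + 1 by rewrite ltr_wpDl.
  (* The 1 in the minimum keeps [x] where the bound is assumed; the 1 added to |C| makes the
     denominator positive. *)
  have d0 : 0 < Num.min 1 (e / (`|C| + 1)) by rewrite lt_min ltr01 divr_gt0.
  have : \forall x \near (0 : R), `|x| < Num.min 1 (e / (`|C| + 1)) by exact: nbhs0_lt.
  apply: filterS => x; rewrite lt_min => /andP[x1 xe].
  have -> : (f \o shift 0 - (cst (f 0) + (\0 : R -> R))) x = f x.
    by rewrite !fctE /= f0 !addr0 subr0.
  apply: le_trans (fC x _) _; first by rewrite (le_trans (ler_norm x)) // ltW.
  apply: (@le_trans _ _ ((`|C| + 1) * `|x| ^+ 2)).
    rewrite real_normK ?num_real // ler_wpM2r ?sqr_ge0 //.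
    by rewrite (le_trans (ler_norm C)) // lerDl.
  rewrite expr2 mulrA ler_wpM2r // mulrC -ler_pdivlMr //; exact: ltW.
have dE : 'd f (0 : R) = \0 :> (R -> R) by apply: diff_unique.
apply: DiffDef => //; apply/diff_locallyP; rewrite dE; split => //.
Qed.

Lemma derive1_is_diff (f : R -> R) t d : is_derive t (1 : R) f d ->
  is_diff t f (fun v => v * d).
Proof.
move=> [df dE]; have fd : differentiable f t by exact/derivable1_diffP.
apply: DiffDef => //; rewrite (deriv1E df) derive1E dE.
by apply/funext.
Qed.

Lemma flat_is_diff p t :
  is_diff t (flat p) (fun v => v * flat ('X^2 * (p - p^`())) t).
Proof.
have [t0|t0|<-] := ltgtP 0 t.
- have tn0 : t != 0 by rewrite gt_eqF.
  have dV : is_derive t (1 : R) (fun u : R => u^-1) (- t ^- 2).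
    have did : derivable (@id R) t (1 : R) by exact: derivable_id.
    apply: DeriveDef; first exact: derivableV.
    by rewrite (deriveV tn0 did) derive_id /GRing.scale /= mulr1.
  have dN : is_derive t (1 : R) (fun u : R => - u^-1) (t ^- 2).
    by have := is_deriveN dV; rewrite opprK.
  have d1 := is_derive1_comp (is_derive_poly p t^-1) dV.
  have d2 := @is_derive1_comp R expR (fun u => - u^-1) t _ _ (is_derive_expR _) dN.
  have d3 := is_deriveM d1 d2.
  have := derive1_is_diff d3.
  have -> : (fun v => v * flat ('X^2 * (p - p^`())) t) = (fun v =>
     v * ((horner p \o (fun u => u^-1)) t *: (expR (- t^-1) * t ^- 2) +
          (expR \o (fun u => - u^-1)) t *: (p^`().[t^-1] * - t ^- 2))).
    apply/funext => v; rewrite /flat t0 !hornerE /= /GRing.scale /=.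
    by field; rewrite tn0.
  apply: near_is_diff.
  have : \forall u \near t, 0 < u by exact: lt_nbhsr.
  by apply: filterS => u u0; rewrite /flat u0.
- have -> : (fun v => v * flat ('X^2 * (p - p^`())) t) = (fun=> 0).
    by apply/funext => v; rewrite /flat ltNge ltW // mulr0.
  apply: near_zero_is_diff; near=> u; rewrite /flat ltNge ltW //.
  by near: u; exact: lt_nbhsl.
- have -> : (fun v => v * flat ('X^2 * (p - p^`())) 0) = (fun=> 0).
    by apply/funext => v; rewrite /flat ltxx mulr0.
  by have [C fC] := flat_le p; exact: square_bound_is_diff fC.
Unshelve. all: by end_near. Qed.

Lemma smooth_flat p : smooth_on setT (flat p).
Proof.
move=> k; elim: k p => [|k IH] p.
  by move=> t _; apply: differentiable_continuous; case: (flat_is_diff p t).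
apply: (Ck_on_is_diff openT (fun t _ => flat_is_diff p t)) => v.
exact: (Ck_on_scale v openT (IH _)).
Qed.

End Flat.

Section Bump.
Variables (R : realType) (n : nat).

(** [flat 1] is exp(-1/t) for positive t. The Euclidean square replaces the sup norm of row vectors
    to keep the argument polynomial. *)
Definition bump (a : 'rV[R]_n) (r : R) (u : 'rV[R]_n) : R :=
  flat 1 (r ^+ 2 - \sum_i (u 0 i - a 0 i) ^+ 2).

(** A compact box that contains every point where [bump] is nonzero. *)
Definition cube (a : 'rV[R]_n) (r : R) : set 'rV[R]_n :=
  [set u | forall i, u 0 i \in `[a 0 i - r, a 0 i + r]].

Lemma compact_cube a r : compact (cube a r).
Proof.
apply: (@rV_compact R n (fun i => [set` `[a 0 i - r, a 0 i + r]])) => i.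
exact: segment_compact.
Qed.

Lemma bump_center a r : 0 < r -> bump a r a != 0.
Proof.
move=> r0; rewrite /bump /flat big1 => [|i _]; last by rewrite subrr expr0n.
by rewrite subr0 exprn_gt0 // hornerC mul1r gt_eqF // expR_gt0.
Qed.

Lemma bump_support a r u : 0 < r -> bump a r u != 0 -> cube a r u.
Proof.
move=> r0; rewrite /bump /flat; case: ifP => [q0 _ i|]; last by rewrite eqxx.
have h : (u 0 i - a 0 i) ^+ 2 <= r ^+ 2.
  move: q0; rewrite subr_gt0 => /ltW; apply: le_trans.
  by rewrite (bigD1 i) //= lerDl sumr_ge0 // => j _; rewrite sqr_ge0.
have : `|u 0 i - a 0 i| <= r.
  by rewrite -ler_sqr ?nnegrE ?normr_ge0 ?(ltW r0) // real_normK ?num_real.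
by rewrite in_itv /= ler_distl => /andP[-> ->].
Qed.

Lemma smooth_bump a r : smooth_on setT (bump a r).
Proof.
have oT : open [set: 'rV[R]_n] by exact: openT.
have sid : smooth_on [set: 'rV[R]_n] id by exact: smooth_on_id.
have sq : smooth_on setT (fun u : 'rV[R]_n => r ^+ 2 - \sum_i (u 0 i - a 0 i) ^+ 2).
  apply: smooth_on_add => //; first exact: smooth_on_cst.
  have -> : (fun u : 'rV[R]_n => - (\sum_i (u 0 i - a 0 i) ^+ 2)) =
            (fun u => \sum_i (a 0 i - u 0 i) *: (u 0 i - a 0 i)).
    apply/funext => u; rewrite -sumrN; apply: eq_bigr => i _.
    by rewrite /GRing.scale /= -mulNr opprB.
  move=> k; apply: Ck_on_sum => // i.
  have si : smooth_on setT (fun u : 'rV[R]_n => u 0 i) by exact: smooth_on_coord.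
  have s1 : smooth_on setT (fun u : 'rV[R]_n => u 0 i - a 0 i).
    by apply: smooth_on_add => //; exact: smooth_on_cst.
  apply: smooth_on_scaler => //.
  have -> : (fun u : 'rV[R]_n => a 0 i - u 0 i) = (fun u => (-1) *: (u 0 i - a 0 i)).
    by apply/funext => u; rewrite scaleN1r opprB.
  exact: smooth_on_scale.
(* The scalar is wrapped as a 1 x 1 matrix because [smooth_on_comp] goes through row vectors. *)
have sv : smooth_on setT (fun u : 'rV[R]_n =>
    const_mx (r ^+ 2 - \sum_i (u 0 i - a 0 i) ^+ 2) : 'rV[R]_1).
  apply: smooth_on_mx => // i j.
  by under eq_fun do rewrite mxE.
have sf : smooth_on setT (fun w : 'rV[R]_1 => flat 1 (w 0 0)).
  apply: (@smooth_on_comp_lin _ _ _ _ setT setT (fun w : 'rV[R]_1 => w 0 0)) => //.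
  - exact: openT.
  - by move=> b u v; rewrite !mxE.
  - exact: coord_continuous.
  - exact: smooth_flat.
have := smooth_on_comp oT (fun _ _ => I) sv sf.
apply: smooth_on_eq => // u _.
by rewrite mxE.
Qed.

Variable M : manifold R n.

(** The factor [a] is the value of [bump] at its centre. It is not normalized to 1, since the
    conditions tested with [Y] are linear in its value. *)
Lemma exists_vfield (x : M) (w : 'rV[R]_n) : exists Y : vfield M,
  smooth_vfield Y /\ exists2 a : R, a != 0 & Y x = a *: w.
Proof.
have [Mc cx] := chart_atP x; set c := chart_at x in Mc cx *.
have [e /= e0 eB] : nbhs_ball (cmap c x) (cimg c).
  by apply/nbhs_ballP; exact: near_cimg.
(* Half the radius, so that the closed cube fits inside the open ball. *)
pose r := e / 2; have r0 : 0 < r by rewrite divr_gt0.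
have Kc : cube (cmap c x) r `<=` cimg c.
  move=> u Ku; apply: eB; split => // i j; rewrite !ord1.
  rewrite -ball_normE /= distrC.
  have := Ku j; rewrite in_itv /= -ler_distl => /le_lt_trans; apply.
  by rewrite /r ltr_pdivrMr // ltr_pMr // ltr1n.
(* The compact cube has a compact image, which is closed as [M] is Hausdorff. This makes the
   extension by zero smooth outside the domain of [c]. *)
have cK : closed (cinv c @` cube (cmap c x) r).
  apply: compact_closed; first exact: m_hausdorff.
  apply: continuous_compact; last exact: compact_cube.
  apply: continuous_in_subspaceT => u; rewrite inE => Ku.
  exact: (m_cinv_cont Mc (Kc _ Ku)).
pose Y : vfield M := fun z => if pselect (cdom c z) is left _
  then bump (cmap c x) r (cmap c z) *: (w *m invmx (tc c z)) else 0.
have Yin z : cdom c z -> Y z = bump (cmap c x) r (cmap c z) *: (w *m invmx (tc c z)).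
  by rewrite /Y; case: pselect.
exists Y; split; last first.
  exists (bump (cmap c x) r (cmap c x)); first exact: bump_center.
  by rewrite Yin // tc_chart_at invmx1 mulmx1.
have vY d z : charts M d -> cdom d z -> vrep d Y (cmap d z) = Y z *m tc d z.
  by move=> Md dz; rewrite /vrep tc.unlock m_cmapK.
move=> d Md; apply: smooth_on_local => _ [z dz <-].
have [cz|ncz] := pselect (cdom c z).
  have oB : open (cmap d @` (cdom d `&` cdom c)).
    by apply: open_chart_image => //; exact: m_dom_open.
  have st : smooth_on (cmap d @` (cdom d `&` cdom c)) (trans d c) by exact: smooth_trans.
  exists (cmap d @` (cdom d `&` cdom c)), (fun u => bump (cmap c x) r (trans d c u) *:
    (w *m jac (trans c d) (trans d c u))); split => //.
  - by exists z.
  - apply: smooth_on_scaler => //.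
      exact: (smooth_on_comp oB (fun _ _ => I) st (smooth_bump _ _)).
    apply: smooth_on_mulmx => //; first exact: smooth_on_cst.
    have oc := open_chart_image Mc (m_dom_open Md).
    apply: (smooth_on_comp oB _ st (smooth_on_jac oc (smooth_trans Mc Md))).
    by move=> _ [y [dy cy] <-]; rewrite trans_cmap //; exists y.
  - move=> _ [y [dy cy] <-].
    rewrite vY // Yin // trans_cmap // -scalemxAl (tc_trans Mc Md cy dy).
    by rewrite mulmxA mulmxKV //; exact: tc_unit.
(* An open neighbourhood of [z] on which [Y] vanishes: inside the chart since [bump] does, outside
   by definition. *)
pose O := ~` (cinv c @` cube (cmap c x) r).
have oO : open O by exact: closed_openC.
exists (cmap d @` (cdom d `&` O)), (fun=> 0); split.
- exact: open_chart_image.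
- exists z => //; split => // -[u Ku uz]; apply: ncz; rewrite -uz.
  exact: cinv_dom (Kc _ Ku).
- exact: smooth_on_cst.
move=> _ [y [dy Oy] <-]; rewrite vY //.
have [cy|ncy] := pselect (cdom c y); last first.
  by rewrite /Y; case: pselect => // _; rewrite mul0mx.
rewrite Yin //; have [->|b0] := eqVneq (bump (cmap c x) r (cmap c y)) 0.
  by rewrite scale0r mul0mx.
by exfalso; apply: Oy; exists (cmap c y); [exact: bump_support b0|exact: m_cmapK].
Qed.

End Bump.

(** A field whose value is a nonzero multiple of the i-th basis vector tests the i-th rows of the
    two derivatives; the multiple is then cancelled. *)
Lemma affine_jet_commutes (R : realType) (n : nat) (M : manifold R n)
    (s : M -> shjet M) (hs : symmetry_jet s) (J : shjet M) :
  affine_jet (nabla s) J <-> sym_commutes s J.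
Proof.
have [Mc cx] := chart_atP (jsrc J); have [Md dy] := chart_atP (jtgt J).
apply: iff_trans (affine_jetP hs J) _; split=> [H|H v Y _].
  apply: (affineD_sym_commutes hs); apply/funext => v.
  apply/row_matrixP => i; rewrite !rowE.
  have [Y [sY [a a0 Yx]]] := exists_vfield (jsrc J) (delta_mx 0 i).
  have := H v Y sY; rewrite Yx -!scalemxAl; exact: scalerI.
exact (congr1 (fun f => Y (jsrc J) *m f v) (sym_commutes_affineD hs Mc Md cx dy H)).
Qed.

Theorem proposition3p3 (R : realType) (n : nat) (M : manifold R n)
    (s : M -> shjet M) (hs : symmetry_jet s) :
  exists S : B1 M -> shjet M,
    [/\ unique (fun S' : B1 M -> shjet M =>
          [/\ lie_groupoid_morphism S',
              (forall x : M, S' (B1neg x) = s x) &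
              (forall xi : B1 M, jp (S' xi) = xi)]) S,
        [set J : shjet M | affine_jet (nabla s) J] = range S &
        (holonomic_symmetry_jet s -> forall xi : B1 M, holonomic_jet (S xi))].
Proof.
have Sjp := symS_jp hs; have Sc := symS_commutes hs.
exists (symS hs); split; last by move=> hol xi; exact: symS_holonomic.
  split; first split.
  - by split; [exact: (S_smooth hs Sjp Sc)|exact: (S_mul hs Sjp Sc)].
  - exact: (S_neg hs Sjp Sc).
  - exact: Sjp.
  (* Each S'(xi) commutes with [s] and lies over [xi], so it is the jet chosen by [symS]. *)
  move=> S' [[_ S'mul] S'neg S'jp]; apply/funext => xi; apply: esym.
  have h := morphism_commutes hs S'mul S'neg S'jp xi.
  by rewrite (symS_unique hs h) S'jp.
(* The preimage of an affine jet [J] under the morphism is [jp J]. *)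
apply/seteqP; split=> [J /(affine_jet_commutes hs) h|_ [xi _ <-]].
  by exists (jp J) => //; rewrite -(symS_unique hs h).
exact/(affine_jet_commutes hs)/Sc.
Qed.
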